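(* Let $M$ be a Riemann surface different from $S^2$ and $f:M\to\mathbb{CP}^2$ a conformal immersion without complex points. Then either $f$ has a global lift $\mathfrak f:M\to S^5$, or there exists a $3$-fold covering $\tau:\hat M\to M$ of $M$ such that the immersion $\hat f=f\circ\tau:\hat M\to\mathbb{CP}^2$ has a global lift to $S^5$, while the given $f:M\to\mathbb{CP}^2$ has not.
   Context: $\pi:S^5\to\mathbb{CP}^2$ is the Hopf fibration from the unit sphere $S^5\subset\mathbb C^3$; $\mathbb{CP}^2$ carries the Fubini-Study metric. A global lift of a map $f:X\to\mathbb{CP}^2$ is a smooth map $\mathfrak f:X\to S^5$ with $f=\pi\circ\mathfrak f$. A point $p\in M$ is a complex point of $f$ if $df(T_pM)$ is a complex line in $T_{f(p)}\mathbb{CP}^2$. *)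

(* Defs.v *)
From HB Require Import structures.
From mathcomp Require Import all_boot all_order all_algebra.
From mathcomp Require Import all_classical all_reals all_analysis.
From mathcomp.real_closed Require Import complex.

Set Implicit Arguments.
Unset Strict Implicit.
Unset Printing Implicit Defensive.

Import Order.TTheory GRing.Theory Num.Theory.
Import numFieldNormedType.Exports.

Local Open Scope classical_set_scope.
Local Open Scope ring_scope.
Local Open Scope complex_scope.

(* The name [Cplx R] keeps the bundled structure visible, so that the topology
   and normed-module instances of numeric fields apply to [R[i]]. *)
Definition Cplx (R : realType) : numClosedFieldType := R[i].

Definition re (R : realType) (z : Cplx R) : R := complex.Re z.
Definition im (R : realType) (z : Cplx R) : R := complex.Im z.

Definition to_Cplx (R : realType) (x : R * R) : Cplx R := x.1 +i* x.2.
Definition of_Cplx (R : realType) (z : Cplx R) : R * R := (re z, im z).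

(* All iterated directional derivatives of order at most [k] exist on [U], and
   those of order exactly [k] are continuous on [U]; for open [U] this is the
   class C^k. *)
Fixpoint Ck (R : realType) (k : nat) (U : set (R * R)) (g : R * R -> R)
    : Prop :=
  match k with
  | 0 => forall x, U x -> {for x, continuous g}
  | k'.+1 => forall v : R * R,
      (forall x, U x -> derivable g x v) /\ Ck k' U (fun x => 'D_v g x)
  end.

Definition smooth_on (R : realType) (U : set (R * R)) (g : R * R -> R) : Prop :=
  forall k, Ck k U g.

Definition smooth_vec (R : realType) n (U : set (R * R))
    (F : R * R -> 'rV[Cplx R]_n) : Prop :=
  forall j : 'I_n, smooth_on U (fun x => re (F x 0 j)) /\
                   smooth_on U (fun x => im (F x 0 j)).

(* The directional derivative, taken separately on real and imaginary parts
   because ['D_v] needs source and target over the same field. *)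
Definition dvec (R : realType) n (F : R * R -> 'rV[Cplx R]_n) (x v : R * R)
    : 'rV[Cplx R]_n :=
  \row_j to_Cplx ('D_v (fun y => re (F y 0 j)) x, 'D_v (fun y => im (F y 0 j)) x).

(* A homeomorphism from the open set [cdom] onto the open set [crange]; values
   of [cmap] and [cinv] outside these sets are irrelevant. *)
Record chart (R : realType) (T : topologicalType) := Chart {
  cdom : set T;
  crange : set (Cplx R);
  cmap : T -> Cplx R;
  cinv : Cplx R -> T;
  cdom_open : open cdom;
  crange_open : open crange;
  cmap_range : forall p, cdom p -> crange (cmap p);
  cinv_dom : forall z, crange z -> cdom (cinv z);
  cmapK : forall p, cdom p -> cinv (cmap p) = p;
  cinvK : forall z, crange z -> cmap (cinv z) = z;
  cmap_continuous : forall p, cdom p -> {for p, continuous cmap};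
  cinv_continuous : forall z, crange z -> {for z, continuous cinv}
}.

(* Complex differentiability, in the charts [phi] and [psi], at every point
   where the coordinate expression of [h] makes sense. *)
Definition holomorphic_in (R : realType) (S T : topologicalType)
    (phi : chart R S) (psi : chart R T) (h : S -> T) : Prop :=
  forall z : Cplx R, crange phi z -> cdom psi (h (cinv phi z)) ->
    derivable (fun w : Cplx R => cmap psi (h (cinv phi w))) z 1.

(* Second countability is not required, being automatic by Rado's theorem. *)
Record riemannSurface (R : realType) := RiemannSurface {
  rs_space :> topologicalType;
  atlas : set (chart R rs_space);
  rs_nonempty : [set: rs_space] !=set0;
  rs_hausdorff : hausdorff_space rs_space;
  rs_connected : connected [set: rs_space];
  atlas_cover : forall p : rs_space, exists2 phi, atlas phi & cdom phi p;
  atlas_compatible : forall phi psi, atlas phi -> atlas psi ->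
    holomorphic_in phi psi id
}.

Arguments atlas {R} _.

Definition holomorphic_map (R : realType) (X Y : riemannSurface R) (h : X -> Y)
    : Prop :=
  continuous h /\
  forall phi psi, atlas X phi -> atlas Y psi -> holomorphic_in phi psi h.

(* [s] is the inverse of the homeomorphism of the sheet [V k] onto [U]. *)
Definition covering_map (n : nat) (X Y : topologicalType) (h : X -> Y) : Prop :=
  continuous h /\
  forall y : Y, exists U : set Y, [/\ open U, U y &
    exists V : 'I_n -> set X,
      [/\ forall k, open (V k),
          trivIset [set: 'I_n] V,
          h @^-1` U = \bigcup_k V k &
          forall k, exists s : Y -> X,
            [/\ {within U, continuous s}, s @` U = V k &
                forall u, U u -> h (s u) = u]]].

Definition homeomorphic_S2 (R : realType) (X : topologicalType) : Prop :=
  let S2 := [set x : 'rV[R]_3 | \sum_j x 0 j ^+ 2 = 1] in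
  exists (g : X -> 'rV[R]_3) (h : 'rV[R]_3 -> X),
    [/\ continuous g, {within S2, continuous h}, g @` [set: X] = S2 &
        cancel g h].

Definition S5 (R : realType) :=
  {z : 'rV[Cplx R]_3 | \sum_j `|z 0 j| ^+ 2 == 1}.

Definition CP2 (R : realType) :=
  {l : {vspace 'rV[Cplx R]_3} | \dim l == 1%N}.

Lemma hopf_subproof (R : realType) (z : S5 R) : \dim <[val z]>%VS == 1%N.
Proof.
rewrite dim_vline; case: (eqVneq (val z) 0) => // z0.
case: z z0 => z /= /eqP hz z0; move: hz; rewrite z0 big1 => [/eqP|j _].
  by rewrite eq_sym oner_eq0.
by rewrite mxE normr0 expr0n.
Qed.

Definition hopf (R : realType) (z : S5 R) : CP2 R :=
  exist (fun l : {vspace 'rV[Cplx R]_3} => \dim l == 1%N) _ (hopf_subproof z).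

Definition generator (R : realType) (l : CP2 R) : 'rV[Cplx R]_3 :=
  vpick (val l).

Definition affine_dom (R : realType) (i : 'I_3) : set (CP2 R) :=
  [set l | generator l 0 i != 0].

(* The affine coordinates (z_j / z_i)_j of the line spanned by z; they do not
   depend on the generator.  The constant entry 1 at j = i is kept, so the chart
   takes values in the complex affine plane {z_i = 1}, and tangent vectors read
   in it are the v with v_i = 0, multiplication by 'i being the complex
   structure of the tangent space. *)
Definition affine (R : realType) (i : 'I_3) (l : CP2 R) : 'rV[Cplx R]_3 :=
  (generator l 0 i)^-1 *: generator l.

Definition hdot (R : realType) (u v : 'rV[Cplx R]_3) : Cplx R :=
  \sum_j u 0 j * Num.conj (v 0 j).

(* The Fubini-Study metric at the line spanned by [s], on tangent vectors [u]
   and [v] represented in homogeneous coordinates: the real part of the Hermitian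
   product of the components of [u] and [v] orthogonal to [s], divided by
   |s|^2.  With this normalization [hopf] is a Riemannian submersion; for
   s_i = 1 and u_i = v_i = 0 it is the usual formula in affine coordinates. *)
Definition fubini_study (R : realType) (s u v : 'rV[Cplx R]_3) : R :=
  re ((hdot s s * hdot u v - hdot u s * hdot s v) / hdot s s ^+ 2).

Section Maps.
Variables (R : realType) (M : riemannSurface R).
Implicit Types (phi : chart R M) (f : M -> CP2 R) (p : M).

Definition in_coord phi V (g : M -> V) : R * R -> V :=
  fun x => g (cinv phi (to_Cplx x)).

Definition coord_range phi : set (R * R) := [set x | crange phi (to_Cplx x)].

Definition smooth_CP2 f : Prop :=
  forall i : 'I_3,
    open (f @^-1` @affine_dom R i) /\
    forall phi, atlas M phi ->
      smooth_vec (coord_range phi `&` in_coord phi f @^-1` @affine_dom R i)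
                 (in_coord phi (@affine R i \o f)).

Definition smooth_S5 (F : M -> S5 R) : Prop :=
  forall phi, atlas M phi ->
    smooth_vec (coord_range phi) (in_coord phi (fun p => val (F p))).

Definition has_global_lift f : Prop :=
  exists F : M -> S5 R, smooth_S5 F /\ f = @hopf R \o F.

Definition charts_at f p phi (i : 'I_3) : Prop :=
  [/\ atlas M phi, cdom phi p & affine_dom i (f p)].

(* df_p, with T_pM read as R^2 in the chart [phi] and the tangent space of
   [CP2] at f(p) read in the [i]-th affine chart. *)
Definition differential f phi (i : 'I_3) p (v : R * R) : 'rV[Cplx R]_3 :=
  dvec (in_coord phi (@affine R i \o f)) (of_Cplx (cmap phi p)) v.

Definition immersion f : Prop :=
  smooth_CP2 f /\
  forall p phi i, charts_at f p phi i -> injective (differential f phi i p).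

(* The pull-back of the Fubini-Study metric is, in every holomorphic coordinate
   of M, a positive multiple of the Euclidean one. *)
Definition conformal f : Prop :=
  forall p phi i, charts_at f p phi i ->
    exists2 lambda : R, 0 < lambda &
      forall v w : R * R,
        fubini_study (affine i (f p))
          (differential f phi i p v) (differential f phi i p w)
        = lambda * (v.1 * w.1 + v.2 * w.2).

Definition conformal_immersion f : Prop := immersion f /\ conformal f.

(* The condition does not depend on the charts when [f] is smooth. *)
Definition complex_point f p : Prop :=
  exists phi i, charts_at f p phi i /\
    exists2 w : 'rV[Cplx R]_3, w != 0 &
      range (differential f phi i p) = range (fun c : Cplx R => c *: w).

End Maps.

(* Main.v *)
Require Import Defs.
From mathcomp Require Import all_boot all_order all_algebra.
From mathcomp Require Import all_classical all_reals all_analysis.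
From mathcomp.real_closed Require Import complex.
From mathcomp Require Import ring lra.

(* Multiplying a local lift of f by a unit factor c multiplies the determinant
   det(lift, d_1 lift, d_2 lift) by c^3, and a holomorphic change of coordinates
   multiplies it by the positive number |t|^2; it never vanishes, since f has no
   complex points.  Asking it to be positive singles out exactly three lifts near
   every point, permuted by the cube roots of unity.  The pairs (p, z), with z
   the value at p of such a lift, form a three-sheeted covering of M on which
   (p, z) |-> z lifts f.  If it were disconnected, a clopen piece would meet all
   fibres in exactly one point, or all of them in exactly two; the point of the
   fibre thus distinguished would be a global section, that is, a global lift
   of f.  Smoothness of these lifts follows from their continuity, because the
   sixth powers of their components are smooth in affine coordinates. *)

Set Implicit Arguments.
Unset Strict Implicit.
Unset Printing Implicit Defensive.

Import Order.TTheory GRing.Theory Num.Theory.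
Import numFieldNormedType.Exports.

Local Open Scope classical_set_scope.
Local Open Scope ring_scope.
Local Open Scope complex_scope.

(** The normalization constrains the value [z] alone. If a lift is written [c *: a] with [a] an
    affine representative, the Leibniz rule adds only multiples of [a] to the derivatives, so the
    determinant of its frame is [c ^+ 3] times that of [a], and no derivative of [c] occurs. Hence
    the covering can be cut out of the product of [M] with complex 3-space before any lift is known
    to be differentiable. What remains analytic is modest: local lifts are built from continuous
    branches of cube root and square root only, and an algebraic equation for one coordinate turns
    continuity into smoothness. The coordinate changes do need a genuine chain rule, which has to be
    recovered from a notion of smoothness phrased through directional derivatives. Connectedness is
    part of the definition of a Riemann surface; securing it for the total space is what the absence
    of a global lift is used for. *)

Lemma near_cvg (T U : Type) (F : set_system T) {FF : Filter F} (f g : T -> U)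
    (L : set_system U) :
  (\near F, f F = g F) -> f @ F --> L -> g @ F --> L.
Proof.
by move=> fg fL A /fL; apply: filterS2 fg => x /= -> .
Qed.

(** * Limits of complex-valued functions through real and imaginary parts *)

Section ComplexTopology.
Variable R : realType.
Local Notation C := (Cplx R).

Definition rc (x : R) : C := x%:C.

Lemma reK (x : R) : re (rc x) = x.
Proof. by []. Qed.

Lemma rcM (x y : R) : rc (x * y) = rc x * rc y.
Proof. exact: rmorphM. Qed.

Lemma rcV (x : R) : rc x^-1 = (rc x)^-1.
Proof. exact: fmorphV. Qed.

Lemma rc_eq0 (x : R) : (rc x == 0) = (x == 0).
Proof. exact: fmorph_eq0. Qed.

Lemma norm_rc (x : R) : `|rc x| = rc `|x|.
Proof. by rewrite normc_def /= expr0n /= addr0 sqrtr_sqr. Qed.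

Lemma conj_rc (x : R) : Num.conj (rc x) = rc x.
Proof. by apply: conj_Creal; rewrite complex_real. Qed.

Lemma to_CplxK (z : C) : to_Cplx (of_Cplx z) = z.
Proof. by case: z. Qed.

Lemma of_CplxK (x : R * R) : of_Cplx (to_Cplx x) = x.
Proof. by case: x. Qed.

Lemma to_CplxE (x : R * R) : to_Cplx x = rc x.1 + 'i * rc x.2 :> C.
Proof. by rewrite -[LHS]/(x.1 +i* x.2) [LHS]complexE. Qed.

Lemma reD (z w : C) : re (z + w) = re z + re w.
Proof. by case: z; case: w. Qed.

Lemma imD (z w : C) : im (z + w) = im z + im w.
Proof. by case: z; case: w. Qed.

Lemma reB (z w : C) : re (z - w) = re z - re w.
Proof. by case: z; case: w. Qed.

Lemma imB (z w : C) : im (z - w) = im z - im w.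
Proof. by case: z; case: w. Qed.

Lemma reM (z w : C) : re (z * w) = re z * re w - im z * im w.
Proof. by case: z; case: w. Qed.

Lemma imM (z w : C) : im (z * w) = re z * im w + im z * re w.
Proof. by case: z; case: w. Qed.

Lemma eq_re_im (z w : C) : re z = re w -> im z = im w -> z = w.
Proof. by case: z => a b; case: w => c d /= -> ->. Qed.

Lemma norm_re_le (z : C) : rc `|re z| <= `|z|.
Proof. exact: normc_ge_Re. Qed.

Lemma norm_im_le (z : C) : rc `|im z| <= `|z|.
Proof.
(* [im z] is minus the real part of [z * 'i], so the bound for [re] applies. *)
have -> : `|z| = `|z * 'i|.
  by rewrite normrM (normc_def 'i) /= expr0n expr1n add0r sqrtr1 mulr1.
apply: le_trans (norm_re_le _).
by rewrite /rc lecR reM /= mulr0 mulr1 sub0r normrN.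
Qed.

Lemma gt0_rc (e : C) : 0 < e -> exists2 d : R, 0 < d & e = rc d.
Proof.
case: e => a b; rewrite ltcE /= => /andP[/eqP bE a0].
by exists a => //; rewrite bE.
Qed.

Section Cvg.
Context {T : Type} {F : set_system T} {FF : Filter F}.

Lemma cvg_rc (g : T -> R) (l : R) :
  g @ F --> l -> (fun x => rc (g x)) @ F --> rc l.
Proof.
move=> /cvgrPdist_lt h; apply/cvgrPdist_lt => e /gt0_rc[d d0 ->].
apply: filterS (h _ d0) => x; rewrite -rmorphB /= -/(rc _) norm_rc.
by rewrite /rc ltcR.
Qed.

Lemma cvg_re (g : T -> C) (l : C) : g @ F --> l -> @re R \o g @ F --> re l.
Proof.
move=> /cvgrPdist_lt h; apply/cvgrPdist_lt => e e0.
have e0' : 0 < rc e by rewrite /rc ltcR.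
apply: filterS (h _ e0') => x /(le_lt_trans (norm_re_le _)).
by rewrite /rc ltcR reB.
Qed.

Lemma cvg_im (g : T -> C) (l : C) : g @ F --> l -> @im R \o g @ F --> im l.
Proof.
move=> /cvgrPdist_lt h; apply/cvgrPdist_lt => e e0.
have e0' : 0 < rc e by rewrite /rc ltcR.
apply: filterS (h _ e0') => x /(le_lt_trans (norm_im_le _)).
by rewrite /rc ltcR imB.
Qed.

Lemma cvg_to_Cplx (g h : T -> R) (l : R * R) :
  g @ F --> l.1 -> h @ F --> l.2 ->
  (fun x => to_Cplx (g x, h x)) @ F --> to_Cplx l.
Proof.
move=> gl hl; under eq_fun do rewrite to_CplxE /=.
rewrite to_CplxE; apply: cvgD; first exact: cvg_rc.
by apply: cvgMr; exact: cvg_rc.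
Qed.

Lemma cvg_expC (g : T -> C) (l : C) n :
  g @ F --> l -> (fun x => g x ^+ n) @ F --> l ^+ n.
Proof.
move=> gl; elim: n => [|n ih]; first exact: cvg_cst.
under eq_fun do rewrite exprS.
by rewrite exprS; exact: cvgM gl ih.
Qed.

Lemma cvg_sumC (I : Type) (r : seq I) (g : I -> T -> C) (l : I -> C) :
  (forall i, g i @ F --> l i) ->
  (fun x => \sum_(i <- r) g i x) @ F --> \sum_(i <- r) l i.
Proof.
move=> gl; elim: r => [|i r ih].
  by rewrite big_nil; under eq_fun do rewrite big_nil; exact: cvg_cst.
under eq_fun do rewrite big_cons.
by rewrite big_cons; exact: cvgD (gl i) ih.
Qed.

Lemma cvg_conj (g : T -> C) (l : C) :
  g @ F --> l -> (fun x => Num.conj (g x)) @ F --> Num.conj l.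
Proof.
move=> /cvgrPdist_lt h; apply/cvgrPdist_lt => e /h.
by apply: filterS => x; rewrite -rmorphB norm_conjC.
Qed.

End Cvg.

Lemma to_Cplx_continuous : continuous (@to_Cplx R).
Proof.
move=> x; rewrite (_ : @to_Cplx R = fun y => to_Cplx (y.1, y.2)); last first.
  by apply/funext => -[].
exact: (@cvg_to_Cplx _ (nbhs x) _ fst snd x cvg_fst cvg_snd).
Qed.

Lemma of_Cplx_continuous : continuous (@of_Cplx R).
Proof.
move=> z.
exact: (@cvg_pair _ _ _ (nbhs z) (nbhs (re z)) (nbhs (im z)) _ _ _
  (@re R) (@im R) (@cvg_re _ (nbhs z) _ id z cvg_id)
  (@cvg_im _ (nbhs z) _ id z cvg_id)).
Qed.

End ComplexTopology.

(** * Calculus of real directional derivatives with complex values *)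

Section DirectionalDerivative.
Variables (R : realType) (V : normedModType R).
Local Notation C := (Cplx R).
Implicit Types (F G : V -> C) (x v : V).

Definition is_dC F x v (l : C) : Prop :=
  (rc h)^-1 * (F (h *: v + x) - F x) @[h --> (0 : R)^'] --> l.

Lemma line_cvg x v : (h *: v + x) @[h --> (0 : R)^'] --> x.
Proof.
have : (h *: v + x) @[h --> (0 : R)] --> (0 : R) *: v + x.
  by apply: cvgD; [exact: scalel_continuous|exact: cvg_cst].
by rewrite scale0r add0r => vx A /vx; exact: nbhs_dnbhs.
Qed.

Lemma is_dC_re F x v l : is_dC F x v l -> is_derive x v (@re R \o F) (re l).
Proof.
move=> /cvg_re h.
suff h' : h^-1 *: ((@re R \o F \o shift x) (h *: v) - (@re R \o F) x)
    @[h --> (0 : R)^'] --> re l.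
  by apply: DeriveDef; [apply/cvg_ex; exists (re l)|exact: cvg_lim h'].
apply: near_cvg h; near=> h => /=.
by rewrite -rcV reM reK mul0r subr0 reB.
Unshelve. all: by end_near. Qed.

Lemma is_dC_im F x v l : is_dC F x v l -> is_derive x v (@im R \o F) (im l).
Proof.
move=> /cvg_im h.
suff h' : h^-1 *: ((@im R \o F \o shift x) (h *: v) - (@im R \o F) x)
    @[h --> (0 : R)^'] --> im l.
  by apply: DeriveDef; [apply/cvg_ex; exists (im l)|exact: cvg_lim h'].
apply: near_cvg h; near=> h => /=.
by rewrite -rcV imM reK mul0r addr0 imB.
Unshelve. all: by end_near. Qed.

Lemma is_dC_re_im F x v : derivable (@re R \o F) x v ->
  derivable (@im R \o F) x v ->
  is_dC F x v (to_Cplx ('D_v (@re R \o F) x, 'D_v (@im R \o F) x)).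
Proof.
move=> hr hi.
pose q (g : V -> R) (h : R) := h^-1 *: ((g \o shift x) (h *: v) - g x).
have hh : to_Cplx (q (@re R \o F) h, q (@im R \o F) h) @[h --> (0 : R)^'] -->
    to_Cplx ('D_v (@re R \o F) x, 'D_v (@im R \o F) x).
  exact: cvg_to_Cplx.
apply: near_cvg hh; near=> h.
apply: eq_re_im => /=.
  by rewrite -rcV reM reK mul0r subr0 reB.
by rewrite -rcV imM reK mul0r addr0 imB.
Unshelve. all: by end_near. Qed.

(** Uniqueness of the derivative, phrased with the expression that forms the entries of [dvec]. *)
Lemma is_dC_val F x v l : is_dC F x v l ->
  l = to_Cplx ('D_v (@re R \o F) x, 'D_v (@im R \o F) x).
Proof.
move=> Fl; have [_ ->] := is_dC_re Fl; have [_ ->] := is_dC_im Fl.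
by case: l Fl.
Qed.

Lemma near_is_dC F G x v l : {near x, F =1 G} -> is_dC F x v l ->
  is_dC G x v l.
Proof.
move=> FG hh; apply: near_cvg hh.
have FGx : F x = G x by exact: nbhs_singleton FG.
have := @line_cvg x v _ FG; rewrite /nbhs /=; apply: filterS => h /= ->.
by rewrite FGx.
Qed.

Lemma is_dC_line_cvg F x v l : is_dC F x v l ->
  F (h *: v + x) @[h --> (0 : R)^'] --> F x.
Proof.
move=> Fl; rewrite -[X in _ --> X]add0r -[X in X + _](mul0r l).
have h0 : rc h @[h --> (0 : R)^'] --> rc (0 : R).
  by apply: cvg_rc => A; exact: nbhs_dnbhs.
pose q h := (rc h)^-1 * (F (h *: v + x) - F x).
have hh : rc h * q h + F x @[h --> (0 : R)^'] --> rc 0 * l + F x.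
  by apply: cvgD; [exact: cvgM h0 Fl|exact: cvg_cst].
apply: near_cvg hh; near=> h.
rewrite /q mulVKf ?subrK// rc_eq0.
by near: h; exact: nbhs_dnbhs_neq.
Unshelve. all: by end_near. Qed.

Lemma is_dC_cst (c : C) x v : is_dC (fun=> c) x v 0.
Proof.
by rewrite /is_dC; under eq_fun do rewrite subrr mulr0; exact: cvg_cst.
Qed.

Local Notation quot F x v := (fun h => (rc h)^-1 * (F (h *: v + x) - F x)).

Lemma is_dCD F G x v l m : is_dC F x v l -> is_dC G x v m ->
  is_dC (fun y => F y + G y) x v (l + m).
Proof.
move=> Fl Gm.
have hh : quot F x v h + quot G x v h @[h --> (0 : R)^'] --> l + m.
  exact: cvgD Fl Gm.
by apply: near_cvg hh; near=> h; ring.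
Unshelve. all: by end_near. Qed.

Lemma is_dCM F G x v l m : is_dC F x v l -> is_dC G x v m ->
  is_dC (fun y => F y * G y) x v (l * G x + F x * m).
Proof.
move=> Fl Gm.
have hh : quot F x v h * G (h *: v + x) + F x * quot G x v h
    @[h --> (0 : R)^'] --> l * G x + F x * m.
  apply: cvgD; first exact: cvgM Fl (is_dC_line_cvg Gm).
  exact: (cvgM (cvg_cst _) Gm).
by apply: near_cvg hh; near=> h; ring.
Unshelve. all: by end_near. Qed.

Lemma is_dC_conj F x v l : is_dC F x v l ->
  is_dC (fun y => Num.conj (F y)) x v (Num.conj l).
Proof.
move=> /cvg_conj hh; apply: near_cvg hh; near=> h.
rewrite rmorphM rmorphB; congr (_ * _).
by rewrite -rcV; apply: conj_rc.
Unshelve. all: by end_near. Qed.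

Lemma is_dCV F x v l : F x != 0 -> is_dC F x v l ->
  is_dC (fun y => (F y)^-1) x v (- l * (F x)^-1 * (F x)^-1).
Proof.
move=> Fx0 Fl.
have hh : - quot F x v h * (F (h *: v + x))^-1 * (F x)^-1 @[h --> (0 : R)^']
    --> - l * (F x)^-1 * (F x)^-1.
  apply: cvgM; last exact: cvg_cst.
  by apply: cvgM; [exact: cvgN Fl|exact: cvgV Fx0 (is_dC_line_cvg Fl)].
apply: near_cvg hh; near=> h.
have Fh0 : F (h *: v + x) != 0.
  near: h; exact: cvgr_neq0 (is_dC_line_cvg Fl) Fx0.
have h0 : h != 0 by near: h; exact: nbhs_dnbhs_neq.
by field; rewrite Fh0 Fx0 fmorph_eq0.
Unshelve. all: by end_near. Qed.

(* [y^(n+1) - z^(n+1) = (y - z) * S y] with [S z = (n+1) z^n], so dividing the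
   difference quotient of [G] by [S (c _)] gives that of [c]. *)
Lemma is_dC_root (n : nat) (c G : V -> C) x v l : {for x, continuous c} ->
  c x != 0 -> (\near x, c x ^+ n.+1 = G x) -> is_dC G x v l ->
  is_dC c x v (c x * (l * (n.+1%:R * G x)^-1)).
Proof.
move=> cx c0 cG Gl; have cGx : c x ^+ n.+1 = G x by exact: nbhs_singleton cG.
have cl : c (h *: v + x) @[h --> (0 : R)^'] --> c x.
  exact: (cvg_comp _ _ (@line_cvg x v) cx).
pose S (y : C) := \sum_(i < n.+1) y ^+ (n.+1.-1 - i) * c x ^+ i.
have Sl : S (c (h *: v + x)) @[h --> (0 : R)^'] --> S (c x).
  apply: cvg_sumC => i; apply: cvgM; last exact: cvg_cst.
  exact: cvg_expC.
have Sx : S (c x) = n.+1%:R * c x ^+ n.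
  rewrite /S (eq_bigr (fun=> c x ^+ n)) => [|i _]; last first.
    by rewrite -exprD subnK// -ltnS.
  by rewrite sumr_const card_ord mulr_natl.
have Sx0 : S (c x) != 0 by rewrite Sx mulf_neq0 ?expf_neq0// pnatr_eq0.
have -> : c x * (l * (n.+1%:R * G x)^-1) = l * (S (c x))^-1.
  rewrite Sx -cGx exprS; field.
  by rewrite addrC -[1]/(1%:R) -natrD addn1 pnatr_eq0 c0 expf_neq0.
have hh : quot G x v h * (S (c (h *: v + x)))^-1 @[h --> (0 : R)^']
    --> l * (S (c x))^-1.
  by apply: cvgM; [exact: Gl|exact: cvgV Sx0 Sl].
apply: near_cvg hh; near=> h.
have Sh0 : S (c (h *: v + x)) != 0.
  by near: h; exact: cvgr_neq0 Sl Sx0.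
have <- : c (h *: v + x) ^+ n.+1 = G (h *: v + x).
  by near: h; exact: (@line_cvg x v _ cG).
by rewrite -cGx subrXX -/(S _) mulrA mulfK.
Unshelve. all: by end_near. Qed.

End DirectionalDerivative.

(** * Classes of differentiability for complex-valued functions *)

Section SmoothComplexFunctions.
Variable R : realType.
Local Notation C := (Cplx R).
Implicit Types (U W : set (R * R)) (F G c : R * R -> C) (k : nat).

(** Unlike in [Ck], the derivative is a witness prescribed on [U] only, so that a formula can be
    supplied for it, and continuity is demanded at every order, so that the classes decrease in
    [k]. *)
Fixpoint CC k U F : Prop :=
  match k with
  | 0 => forall x, U x -> {for x, continuous F}
  | k'.+1 => (forall x, U x -> {for x, continuous F}) /\
      forall v, exists F', (forall x, U x -> is_dC F x v (F' x)) /\ CC k' U F'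
  end.

Lemma CC_pred k U F : CC k.+1 U F -> CC k U F.
Proof.
elim: k F => [|k ih] F; first by case.
move=> [cF dF]; split=> // v; have [F' [dF' F'k]] := dF v.
by exists F'; split=> //; exact: ih.
Qed.

Lemma CC_sub k U W F : U `<=` W -> CC k W F -> CC k U F.
Proof.
move=> UW; elim: k F => [|k ih] F; first by move=> h x /UW; exact: h.
move=> [cF dF]; split=> [x /UW|v]; first exact: cF.
have [F' [dF' F'k]] := dF v; exists F'; split; last exact: ih.
by move=> x /UW; exact: dF'.
Qed.

Lemma CC_cst k U (z : C) : CC k U (fun=> z).
Proof.
elim: k z => [|k ih] z; first by move=> x _; exact: cvg_cst.
split=> [x _|v]; first exact: cvg_cst.
by exists (fun=> 0); split=> // x _; exact: is_dC_cst.
Qed.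

Lemma CC_add k U F G : CC k U F -> CC k U G -> CC k U (fun x => F x + G x).
Proof.
elim: k F G => [|k ih] F G.
  by move=> hF hG x Ux; apply: cvgD; [exact: hF|exact: hG].
move=> [cF dF] [cG dG]; split=> [x Ux|v].
  by apply: cvgD; [exact: cF|exact: cG].
have [F' [dF' F'k]] := dF v; have [G' [dG' G'k]] := dG v.
exists (fun x => F' x + G' x); split; last exact: ih.
by move=> x Ux; apply: is_dCD; [exact: dF'|exact: dG'].
Qed.

Lemma CC_mul k U F G : CC k U F -> CC k U G -> CC k U (fun x => F x * G x).
Proof.
elim: k F G => [|k ih] F G.
  by move=> hF hG x Ux; apply: cvgM; [exact: hF|exact: hG].
move=> hF hG; have [cF dF] := hF; have [cG dG] := hG; split=> [x Ux|v].
  by apply: cvgM; [exact: cF|exact: cG].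
have [F' [dF' F'k]] := dF v; have [G' [dG' G'k]] := dG v.
exists (fun x => F' x * G x + F x * G' x); split.
  by move=> x Ux; apply: is_dCM; [exact: dF'|exact: dG'].
by apply: CC_add; apply: ih => //; exact: CC_pred.
Qed.

Lemma CC_opp k U F : CC k U F -> CC k U (fun x => - F x).
Proof.
move=> hF; rewrite (_ : (fun x => _) = (fun x => -1 * F x)).
  by apply: CC_mul => //; exact: CC_cst.
by apply/funext => x; rewrite mulN1r.
Qed.

Lemma CC_exp k U F n : CC k U F -> CC k U (fun x => F x ^+ n).
Proof.
move=> hF; elim: n => [|n ih]; first exact: CC_cst.
by under eq_fun do rewrite exprS; exact: CC_mul.
Qed.

Lemma CC_sum k U (I : Type) (r : seq I) (F : I -> R * R -> C) :
  (forall i, CC k U (F i)) -> CC k U (fun x => \sum_(i <- r) F i x).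
Proof.
move=> hF; elim: r => [|i r ih].
  by under eq_fun do rewrite big_nil; exact: CC_cst.
by under eq_fun do rewrite big_cons; exact: CC_add.
Qed.

Lemma CC_conj k U F : CC k U F -> CC k U (fun x => Num.conj (F x)).
Proof.
elim: k F => [|k ih] F; first by move=> hF x /hF /cvg_conj.
move=> [cF dF]; split=> [x /cF /cvg_conj //|v].
have [F' [dF' F'k]] := dF v.
exists (fun x => Num.conj (F' x)); split; last exact: ih.
by move=> x Ux; apply: is_dC_conj; exact: dF'.
Qed.

Lemma CC_inv k U F : (forall x, U x -> F x != 0) -> CC k U F ->
  CC k U (fun x => (F x)^-1).
Proof.
move=> F0; elim: k => [|k ih] hF.
  by move=> x Ux; apply: cvgV; [exact: F0|exact: hF].
have [cF dF] := hF; split=> [x Ux|v].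
  by apply: cvgV; [exact: F0|exact: cF].
have [F' [dF' F'k]] := dF v.
exists (fun x => - F' x * (F x)^-1 * (F x)^-1); split.
  by move=> x Ux; apply: is_dCV; [exact: F0|exact: dF'].
have iF := ih (CC_pred hF).
by apply: CC_mul => //; apply: CC_mul => //; exact: CC_opp.
Qed.

(* The derivative of a root [c] of [G] is [c] times a function of [G] alone, so
   the regularity of [c] bootstraps from its continuity. *)
Lemma CC_root k n U c G : open U -> (forall x, U x -> {for x, continuous c}) ->
  (forall x, U x -> c x != 0) -> (forall x, U x -> c x ^+ n.+1 = G x) ->
  CC k U G -> CC k U c.
Proof.
move=> oU cc c0 cG; elim: k => [|k ih] hG; first exact: cc.
split=> [|v]; first exact: cc.
have [cG' dG] := hG; have [G' [dG' G'k]] := dG v.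
exists (fun x => c x * (G' x * (n.+1%:R * G x)^-1)); split.
  move=> x Ux; apply: is_dC_root (dG' x Ux); [exact: cc|exact: c0|].
  by move/open_nbhs_nbhs : (conj oU Ux); apply: filterS => y; exact: cG.
have Gk := CC_pred hG; apply: CC_mul; first exact: ih.
apply: CC_mul; first exact: G'k.
apply: CC_inv.
  by move=> x Ux; rewrite -cG// mulf_neq0 ?expf_neq0 ?c0// pnatr_eq0.
by apply: CC_mul; [exact: CC_cst|exact: Gk].
Qed.

(** Smoothness of all orders is assumed because the continuity that [CC] asks at each level is read
    off the order-zero clause of [smooth_on], for [F] and then for its derivatives. *)
Lemma CC_of_smooth k U F : smooth_on U (@re R \o F) ->
  smooth_on U (@im R \o F) -> CC k U F.
Proof.
have cF F0 : smooth_on U (@re R \o F0) -> smooth_on U (@im R \o F0) ->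
    forall x, U x -> {for x, continuous F0}.
  move=> hr hi x Ux.
  have h := @cvg_to_Cplx R _ (nbhs x) _ _ _ (_, _) (hr 0 x Ux) (hi 0 x Ux).
  have -> : F0 = (fun y => to_Cplx ((@re R \o F0) y, (@im R \o F0) y)).
    by apply/funext => y; rewrite /= -[LHS]to_CplxK.
  exact: h.
elim: k F => [|k ih] F hr hi; first exact: cF.
split=> [|v]; first exact: cF.
exists (fun x => to_Cplx ('D_v (@re R \o F) x, 'D_v (@im R \o F) x)); split.
  by move=> x Ux; apply: is_dC_re_im;
    [exact: (hr 1 v).1|exact: (hi 1 v).1].
by apply: ih => j; [exact: (hr j.+1 v).2|exact: (hi j.+1 v).2].
Qed.

Lemma CC_smooth U F g : open U -> (forall k, CC k U F) ->
  ((forall x, U x -> g x = re (F x)) -> smooth_on U g) /\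
  ((forall x, U x -> g x = im (F x)) -> smooth_on U g).
Proof.
(* [p] stands for [re] or [im]; the induction uses only that it preserves limits and derivatives. *)
suff key (p : C -> R) : open U ->
    (forall (F0 : R * R -> C) x, F0 @ x --> F0 x -> p \o F0 @ x --> p (F0 x)) ->
    (forall F0 (x v : R * R) l, is_dC F0 x v l ->
      is_derive x v (p \o F0) (p l)) ->
    forall k F0 g0, CC k U F0 -> (forall x, U x -> g0 x = p (F0 x)) ->
      Ck k U g0.
  move=> oU hF; split=> gF k.
    apply: (key (@re R) _ _ _ k F) => // [F0 x|F0 x v l]; first exact: cvg_re.
    exact: is_dC_re.
  apply: (key (@im R) _ _ _ k F) => // [F0 x|F0 x v l]; first exact: cvg_im.
  exact: is_dC_im.
move=> oU pc pd k.
have nU x : U x -> \near x, U x by move=> Ux; exact: open_nbhs_nbhs.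
elim: k => [|k ih] F0 g0.
  move=> cF gF x Ux; suff h : g0 @ x --> g0 x by exact: h.
  rewrite (gF _ Ux).
  apply: near_cvg (pc _ _ (cF x Ux)).
  by apply: filterS (nU x Ux) => y /gF ->.
move=> [cF dF] gF v; have [F' [dF' F'k]] := dF v.
have dg x : U x -> is_derive x v g0 (p (F' x)).
  move=> Ux; apply: near_eq_is_derive (pd _ _ _ _ (dF' x Ux)).
  by apply: filterS (nU x Ux) => y /gF ->.
split=> [x /dg[] //|]; apply: (ih F') => // x /dg[_ ->//].
Qed.

Lemma Ck_sub k U W (g : R * R -> R) : U `<=` W -> Ck k W g -> Ck k U g.
Proof.
move=> UW; elim: k g => [|k ih] g; first by move=> h x /UW; exact: h.
move=> h v; have [d1 d2] := h v; split; last exact: ih.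
by move=> x /UW; exact: d1.
Qed.

Lemma Ck_eq k U (g h : R * R -> R) : open U -> (forall x, U x -> g x = h x) ->
  Ck k U g -> Ck k U h.
Proof.
move=> oU; have nU x : U x -> \near x, U x by move=> Ux; exact: open_nbhs_nbhs.
elim: k g h => [|k ih] g h gh.
  move=> cg x Ux; suff hx : h @ x --> h x by exact: hx.
  rewrite -(gh _ Ux).
  apply: near_cvg (cg x Ux); by apply: filterS (nU x Ux) => y /gh.
have gh' x : U x -> {near x, g =1 h}.
  by move=> Ux; apply: filterS (nU x Ux) => y /gh.
move=> hg v; have [d1 d2] := hg v; split.
  by move=> x Ux; apply: near_eq_derivable (d1 x Ux); exact: gh'.
by apply: ih d2 => x Ux; apply: near_eq_derive; exact: gh'.
Qed.

(** Every clause of [Ck] is a statement at a point, so the sets [U] may be chosen point by point, as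
    the affine index is for a lift. *)
Lemma Ck_local k W (g : R * R -> R) :
  (forall x, W x -> exists2 U, U x & Ck k U g) -> Ck k W g.
Proof.
elim: k g => [|k ih] g h.
  by move=> x /h[U Ux]; exact.
move=> v; split=> [x /h[U Ux /(_ v)[d1 _]]|]; first exact: d1.
by apply: ih => x /h[U Ux /(_ v)[_ d2]]; exists U.
Qed.

End SmoothComplexFunctions.

(** * The chain rule along curves and for holomorphic maps *)

Section ChainRule.
Variable R : realType.
Local Notation C := (Cplx R).

Lemma is_derive_line (V : normedModType R) (g : V -> R) (y v : V) (s : R) :
  derivable g (s *: v + y) v ->
  is_derive s 1 (fun r : R => g (r *: v + y)) ('D_v g (s *: v + y)).
Proof.
move=> dg.
have E : (fun h : R => h^-1 *:
      (((fun r : R => g (r *: v + y)) \o shift s) (h *: 1) - g (s *: v + y))) =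
    (fun h : R => h^-1 *:
      ((g \o shift (s *: v + y)) (h *: v) - g (s *: v + y))).
  apply/funext => h /=; congr (_ *: (g _ - _)).
  by rewrite -[h%:A]/(h * 1) mulr1 scalerDl addrA.
by split; rewrite /derivable /derive E.
Qed.

(** Both signs of [s] are covered, because the increments of a curve along the axes have no definite
    sign. *)
Lemma line_MVT (V : normedModType R) (g : V -> R) (y v : V) (s : R) :
  (forall r : R, `|r| <= `|s| -> derivable g (r *: v + y) v) ->
  exists2 r : R, `|r| <= `|s| &
    g (s *: v + y) - g y = s * 'D_v g (r *: v + y).
Proof.
move=> dg; pose phi := fun r : R => g (r *: v + y).
have dphi (r : R) : `|r| <= `|s| -> is_derive r 1 phi ('D_v g (r *: v + y)).
  by move=> /dg; exact: is_derive_line.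
have phi0 : phi 0 = g y by rewrite /phi scale0r add0r.
have cphi (a b : R) : (forall r, r \in `[a, b] -> `|r| <= `|s|) ->
    {within `[a, b], continuous phi}.
  move=> ab; apply: derivable_within_continuous => r rab.
  by have [] := dphi r (ab r rab).
have [s0|s0] := leP 0 s.
  have sub r : r \in `[0, s] -> `|r| <= `|s|.
    by rewrite in_itv /= => /andP[r0 rs]; rewrite !ger0_norm.
  have [r rs e] := MVT_segment s0
    (fun r hr => dphi r (sub r (subset_itv_oo_cc hr))) (cphi _ _ sub).
  by exists r; [exact: sub|rewrite -/(phi s) -phi0 e subr0 mulrC].
have sub r : r \in `[s, 0] -> `|r| <= `|s|.
  by rewrite in_itv /= => /andP[sr r0]; rewrite !ler0_norm ?lerN2// ltW.
have [r rs e] := MVT_segment (ltW s0)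
  (fun r hr => dphi r (sub r (subset_itv_oo_cc hr))) (cphi _ _ sub).
exists r; first exact: sub.
by rewrite -/(phi s) -phi0 -opprB e sub0r mulrN opprK mulrC.
Qed.

(** Directional derivatives alone do not give a chain rule. The increment of [g] is split into two
    steps parallel to the axes, the mean value theorem is applied to each, and continuity of the two
    partial derivatives yields the limit. *)
Lemma C1_curve (U : set (R * R)) (g : R * R -> R) (gam : R -> R * R)
    (u : R * R) : open U -> smooth_on U g -> U (gam 0) ->
  h^-1 * ((gam h).1 - (gam 0).1) @[h --> (0 : R)^'] --> u.1 ->
  h^-1 * ((gam h).2 - (gam 0).2) @[h --> (0 : R)^'] --> u.2 ->
  h^-1 * (g (gam h) - g (gam 0)) @[h --> (0 : R)^'] -->
    u.1 * 'D_(1, 0) g (gam 0) + u.2 * 'D_(0, 1) g (gam 0).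
Proof.
move=> oU sg; set x := gam 0 => Ux u1 u2.
have /nbhs_ballP[d /= d0 dU] : nbhs x U by exact: open_nbhs_nbhs.
pose a h := (gam h).1 - x.1; pose b h := (gam h).2 - x.2.
have c0 (q : R -> R) (l : R) : h^-1 * q h @[h --> (0 : R)^'] --> l ->
    q h @[h --> (0 : R)^'] --> (0 : R).
  move=> ql.
  have h0 : h @[h --> (0 : R)^'] --> (0 : R) by move=> A; exact: nbhs_dnbhs.
  have hh : h * (h^-1 * q h) @[h --> (0 : R)^'] --> (0 : R).
    by rewrite -[X in _ --> X](mul0r l); exact: cvgM h0 ql.
  apply: near_cvg hh; near=> h; rewrite mulVKf//.
  by near: h; exact: nbhs_dnbhs_neq.
have a0 := c0 a _ u1; have b0 := c0 b _ u2.
(* The broken path goes from [x] horizontally by [a h], then vertically by [b h], and stays in the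
   ball of radius [d] inside [U]. *)
have mvt : \forall h \near (0 : R)^', exists r : R * R,
    [/\ `|r.1| <= `|a h|, `|r.2| <= `|b h| &
    g (gam h) - g x = a h * 'D_(1, 0) g (r.1 *: (1, 0) + x) +
      b h * 'D_(0, 1) g (r.2 *: (0, 1) + (a h *: (1, 0) + x))].
  have na : \forall h \near (0 : R)^', `|a h| < d by exact: cvgr0_norm_lt.
  have nb : \forall h \near (0 : R)^', `|b h| < d by exact: cvgr0_norm_lt.
  near=> h.
  have ad : `|a h| < d by near: h.
  have bd : `|b h| < d by near: h.
  have [r1 r1a e1] : exists2 r : R, `|r| <= `|a h| &
      g (a h *: (1, 0) + x) - g x = a h * 'D_(1, 0) g (r *: (1, 0) + x).
    apply: line_MVT => r ra; apply: (sg 1 (1, 0)).1; apply: dU.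
    split; rewrite /ball /= opprD addrCA subrr addr0 normrN.
      by rewrite -[_ *: _]/(_ * _) mulr1 (le_lt_trans ra).
    by rewrite -[_ *: _]/(_ * _) mulr0 normr0.
  have [r2 r2b e2] : exists2 r : R, `|r| <= `|b h| &
      g (b h *: (0, 1) + (a h *: (1, 0) + x)) - g (a h *: (1, 0) + x) =
      b h * 'D_(0, 1) g (r *: (0, 1) + (a h *: (1, 0) + x)).
    apply: line_MVT => r ra; apply: (sg 1 (0, 1)).1; apply: dU.
    split; rewrite /ball /= !opprD !addrA addrAC [X in X - _]addrAC subrr.
      by rewrite -![_ *: _]/(_ * _) mulr1 mulr0 subr0 sub0r normrN.
    rewrite -![_ *: _]/(_ * _) mulr1 mulr0 subr0 sub0r normrN.
    exact: le_lt_trans ra bd.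
  exists (r1, r2); split => //=; rewrite -e1 -e2.
  have gE : gam h = b h *: (0, 1) + (a h *: (1, 0) + x).
    rewrite /a /b; case: (gam h) => p q; rewrite /=.
    by congr pair; rewrite /= -![_ *: _]/(_ * _) ?mulr1 mulr0 ?add0r subrK.
  by rewrite [in LHS]gE; ring.
(* The intermediate points become functions of [h]; the default [(0, 0)] can occur only away from
   the punctured neighbourhood considered. *)
have [r hr] : exists r : R -> R * R, \forall h \near (0 : R)^',
    [/\ `|(r h).1| <= `|a h|, `|(r h).2| <= `|b h| &
    g (gam h) - g x = a h * 'D_(1, 0) g ((r h).1 *: (1, 0) + x) +
      b h * 'D_(0, 1) g ((r h).2 *: (0, 1) + (a h *: (1, 0) + x))].
  exists (fun h => xget (0, 0) [set r : R * R | [/\ `|r.1| <= `|a h|,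
    `|r.2| <= `|b h| & g (gam h) - g x = a h * 'D_(1, 0) g (r.1 *: (1, 0) + x) +
      b h * 'D_(0, 1) g (r.2 *: (0, 1) + (a h *: (1, 0) + x))]]).
  apply: filterS mvt => h hr.
  exact: (@xgetPex _ (0, 0) [set r : R * R | [/\ _, _ & _]] hr).
have sq (q s : R -> R) : (\forall h \near (0 : R)^', `|q h| <= `|s h|) ->
    s h @[h --> (0 : R)^'] --> (0 : R) -> q h @[h --> (0 : R)^'] --> (0 : R).
  move=> qs s0; apply/cvgr0Pnorm_lt => e e0.
  have se : \forall h \near (0 : R)^', `|s h| < e by exact: cvgr0_norm_lt.
  by apply: filterS2 qs se => h; exact: le_lt_trans.
have r1 : (r h).1 @[h --> (0 : R)^'] --> (0 : R).
  by apply: sq a0; apply: filterS hr => h [].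
have r2 : (r h).2 @[h --> (0 : R)^'] --> (0 : R).
  by apply: sq b0; apply: filterS hr => h [].
have cz (v : R * R) (s : R -> R) (y : R -> R * R) :
    s h @[h --> (0 : R)^'] --> (0 : R) -> y h @[h --> (0 : R)^'] --> x ->
    s h *: v + y h @[h --> (0 : R)^'] --> x.
  move=> s0 yx; rewrite -[X in _ --> X]add0r -[X in X + _](scale0r v).
  by apply: cvgD => //; apply: cvgZr_tmp.
have cx : (fun=> x) h @[h --> (0 : R)^'] --> x by exact: cvg_cst.
have D1 : 'D_(1, 0) g ((r h).1 *: (1, 0) + x) @[h --> (0 : R)^'] -->
    'D_(1, 0) g x.
  have rx := cz (1, 0) (fun h => (r h).1) (fun=> x) r1 cx.
  exact: (cvg_comp _ _ rx ((sg 1 (1, 0)).2 x Ux)).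
have D2 : 'D_(0, 1) g ((r h).2 *: (0, 1) + (a h *: (1, 0) + x))
    @[h --> (0 : R)^'] --> 'D_(0, 1) g x.
  have ax := cz (1, 0) a (fun=> x) a0 cx.
  have rx := cz (0, 1) (fun h => (r h).2) (fun h => a h *: (1, 0) + x) r2 ax.
  exact: (cvg_comp _ _ rx ((sg 1 (0, 1)).2 x Ux)).

have hh : h^-1 * a h * 'D_(1, 0) g ((r h).1 *: (1, 0) + x) +
    h^-1 * b h * 'D_(0, 1) g ((r h).2 *: (0, 1) + (a h *: (1, 0) + x))
    @[h --> (0 : R)^'] --> u.1 * 'D_(1, 0) g x + u.2 * 'D_(0, 1) g x.
  by apply: cvgD; [exact: cvgM u1 D1|exact: cvgM u2 D2].
 apply: near_cvg hh.
by apply: filterS hr => h [_ _ ->]; ring.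
Unshelve. all: by end_near. Qed.

(** Linearity in the direction is not formal for directional derivatives; it is [C1_curve] along a
    straight line. *)
Lemma smooth_derive_lin (U : set (R * R)) (g : R * R -> R) x v : open U ->
  smooth_on U g -> U x ->
  'D_v g x = v.1 * 'D_(1, 0) g x + v.2 * 'D_(0, 1) g x.
Proof.
move=> oU sg Ux; pose gam (h : R) := h *: v + x.
have g0 : gam 0 = x by rewrite /gam scale0r add0r.
have : h^-1 * (g (gam h) - g (gam 0)) @[h --> (0 : R)^'] -->
    v.1 * 'D_(1, 0) g (gam 0) + v.2 * 'D_(0, 1) g (gam 0).
  have cst (p q : R -> R) (l : R) : (forall h, p h = h * l) -> p 0 = 0 ->
    h^-1 * p h @[h --> (0 : R)^'] --> l.
    move=> ph _; apply: near_cvg (cvg_cst l); near=> h.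
    rewrite ph mulKf//; near: h; exact: nbhs_dnbhs_neq.
  apply: (C1_curve oU sg); rewrite ?g0//.
    by apply: (cst _ id) => [h|]; rewrite /= ?scale0r ?add0r ?addrK ?subrr.
  by apply: (cst _ id) => [h|]; rewrite /= ?scale0r ?add0r ?addrK ?subrr.
by rewrite g0 => /cvg_lim; exact.
Unshelve. all: by end_near. Qed.

Lemma holomorphic_is_dC (F : C -> C) x : derivable F (to_Cplx x) 1 ->
  exists t : C, forall v, is_dC (F \o @to_Cplx R) x v (t * to_Cplx v).
Proof.
move=> /cvg_ex[/= t Ft]; exists t => v.
(* For [v = 0] the increment [h *: v] is zero and cannot be substituted into the complex difference
   quotient. *)
have [->|v0] := eqVneq v 0.
  have -> : to_Cplx 0 = 0 :> C by apply: eq_re_im.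
  rewrite mulr0.
  have c0 : (fun=> 0 : C) h @[h --> (0 : R)^'] --> (0 : C) by exact: cvg_cst.
  apply: near_cvg c0; near=> h.
  by rewrite /= scaler0 add0r subrr mulr0.
have z0 : to_Cplx v != 0 :> C.
  by apply: contra_neq v0 => v0; rewrite -[v]of_CplxK v0.
have w0 : rc h * to_Cplx v @[h --> (0 : R)^'] --> (0 : C)^'.
  move=> A; rewrite /dnbhs /within /= => nA.
  have : rc h * to_Cplx v @[h --> (0 : R)^'] --> (0 : C).
    rewrite -[X in _ --> X](mul0r (to_Cplx v)) -[X in X * _]/(rc 0).
    apply: cvgM; last exact: cvg_cst.
    by apply: cvg_rc => B; exact: nbhs_dnbhs.
  move=> /(_ _ nA); rewrite /nbhs /=.
  apply: filterS2 (nbhs_dnbhs_neq (0 : R)) => h h0; apply.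
  by rewrite mulf_neq0// rc_eq0.
pose w h := rc h * to_Cplx v : C.
have hh : (w h)^-1 * (F ((w h)%:A + to_Cplx x) - F (to_Cplx x)) * to_Cplx v
    @[h --> (0 : R)^'] --> (t * to_Cplx v : C).
  by apply: cvgM; [exact: (cvg_comp _ _ w0 Ft)|exact: cvg_cst].
apply: near_cvg hh; near=> h.
have h0 : h != 0 by near: h; exact: nbhs_dnbhs_neq.
rewrite /w /=.
have -> : (rc h * to_Cplx v)%:A + to_Cplx x = to_Cplx (h *: v + x) :> C.
  rewrite -[_%:A]/(_ * 1) mulr1.
  apply: eq_re_im; rewrite ?(reD, imD) ?(reM, imM) /=.
    by rewrite mul0r subr0.
  by rewrite mul0r addr0.
by rewrite invfM mulrAC mulfVK.
Unshelve. all: by end_near. Qed.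

(** The image under [F] of the line through [x] is a curve with velocity [t * to_Cplx v] at [0], to
    which [C1_curve] applies. *)
Lemma derive_comp_holomorphic (U : set (R * R)) (g : R * R -> R) (F : C -> C)
    (t : C) x v : open U -> smooth_on U g -> U (of_Cplx (F (to_Cplx x))) ->
  is_dC (F \o @to_Cplx R) x v (t * to_Cplx v) ->
  'D_v (fun y => g (of_Cplx (F (to_Cplx y)))) x =
    'D_(of_Cplx (t * to_Cplx v)) g (of_Cplx (F (to_Cplx x))).
Proof.
move=> oU sg Ux Ft; rewrite (smooth_derive_lin _ oU sg Ux).
pose gam (h : R) := of_Cplx (F (to_Cplx (h *: v + x))).
have gam0 : gam 0 = of_Cplx (F (to_Cplx x)) by rewrite /gam scale0r add0r.
rewrite -gam0 in Ux *.
have := C1_curve (u := of_Cplx (t * to_Cplx v)) oU sg Ux.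
pose q h : C := (rc h)^-1 * (F (to_Cplx (h *: v + x)) - F (to_Cplx x)).
rewrite gam0 => h; apply: cvg_lim => //; apply: h.
  have hr : re (q h) @[h --> (0 : R)^'] --> re (t * to_Cplx v).
    by exact: cvg_re Ft.
  suff : h^-1 * (re (F (to_Cplx (h *: v + x))) - re (F (to_Cplx x)))
      @[h --> (0 : R)^'] --> re (t * to_Cplx v) by exact.
  by apply: (near_cvg _ hr); near=> h; rewrite /q -rcV reM reK mul0r subr0 reB.
have hi : im (q h) @[h --> (0 : R)^'] --> im (t * to_Cplx v).
  by exact: cvg_im Ft.
suff : h^-1 * (im (F (to_Cplx (h *: v + x))) - im (F (to_Cplx x)))
    @[h --> (0 : R)^'] --> im (t * to_Cplx v) by exact.
by apply: (near_cvg _ hi); near=> h; rewrite /q -rcV imM reK mul0r addr0 imB.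
Unshelve. all: by end_near. Qed.

End ChainRule.

(** * Determinants of frames and derivatives of vector-valued maps *)

Lemma I3_ind (P : 'I_3 -> Prop) : P 0 -> P 1 -> P 2%:R -> forall i, P i.
Proof.
move=> P0 P1 P2 [[|[|[|//]]] hi].
- by rewrite (_ : Ordinal hi = 0)//; exact/val_inj.
- by rewrite (_ : Ordinal hi = 1)//; exact/val_inj.
- by rewrite (_ : Ordinal hi = 2%:R)//; exact/val_inj.
Qed.

Section Jet.
Variable R : realType.
Local Notation C := (Cplx R).
Local Notation V3 := 'rV[Cplx R]_3.

(** Expanded by cofactors so that the transformation rules become polynomial identities for
    [ring]. *)
Definition det3 (u v w : V3) : C :=
  u 0 0 * (v 0 1 * w 0 2%:R - v 0 2%:R * w 0 1)
  - u 0 1 * (v 0 0 * w 0 2%:R - v 0 2%:R * w 0 0)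
  + u 0 2%:R * (v 0 0 * w 0 1 - v 0 1 * w 0 0).

(** For a rescaled lift, [k] is the scaling factor and [m], [n] are its two partial derivatives, as
    the Leibniz rule produces them. *)
Lemma det3_gauge (k m n : C) (a v w : V3) :
  det3 (k *: a) (k *: v + m *: a) (k *: w + n *: a) = k ^+ 3 * det3 a v w.
Proof. by rewrite /det3 !mxE; ring. Qed.

(** With [s], [t] the real and imaginary parts of a complex derivative, this is the effect of a
    holomorphic change of coordinate on the tangent frame. *)
Lemma det3_rotate (s t : C) (a v w : V3) :
  det3 a (s *: v + t *: w) (- t *: v + s *: w) = (s ^+ 2 + t ^+ 2) * det3 a v w.
Proof. by rewrite /det3 !mxE; ring. Qed.

(** The determinant reduces, up to sign, to the minor of [v], [w] that avoids column [i]; the other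
    two minors contain a zero column. Once all three vanish, [w] is proportional to the nonzero
    [v]. *)
Lemma det3_eq0 (i : 'I_3) (a v w : V3) : a 0 i = 1 -> v 0 i = 0 -> w 0 i = 0 ->
  v != 0 -> det3 a v w = 0 -> exists m : C, w = m *: v.
Proof.
move=> a1 vi wi v0 d0.
have minor0 : v 0 1 * w 0 2%:R = v 0 2%:R * w 0 1 /\
    v 0 0 * w 0 2%:R = v 0 2%:R * w 0 0 /\ v 0 0 * w 0 1 = v 0 1 * w 0 0.
  move: i a1 vi wi d0; rewrite /det3; apply: I3_ind => -> -> ->;
    rewrite !(mul0r, mulr0, mul1r, subrr, oppr0, subr0, sub0r, addr0, add0r).
  - by move/subr0_eq.
  - by move/eqP; rewrite oppr_eq0 subr_eq0 => /eqP.
  - by move/subr0_eq.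
have minor j k : v 0 j * w 0 k = v 0 k * w 0 j.
  have [m1 [m2 m3]] := minor0.
  move: j k; do 2 (apply: I3_ind => //); rewrite ?m1 ?m2 ?m3 //.
have [j vj] : exists j, v 0 j != 0.
  by apply/existsP; apply: contraNT v0 => /existsPn v0; apply/eqP/rowP => j;
    rewrite mxE; have /negPn/eqP := v0 j.
exists (w 0 j / v 0 j); apply/rowP => k; rewrite mxE.
by apply: (mulIf vj); rewrite [RHS]mulrAC mulfVK// mulrC minor mulrC.
Qed.

Lemma smooth_vec_is_dC (U : set (R * R)) n (F : R * R -> 'rV[C]_n) x v j :
  smooth_vec U F -> U x -> is_dC (fun y => F y 0 j) x v (dvec F x v 0 j).
Proof.
move=> sF Ux; rewrite mxE; have [sr si] := sF j.
by apply: is_dC_re_im; [exact: (sr 1 v).1|exact: (si 1 v).1].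
Qed.

Lemma smooth_vec_CC (U : set (R * R)) n (F : R * R -> 'rV[C]_n) k j :
  smooth_vec U F -> CC k U (fun y => F y 0 j).
Proof. by move=> /(_ j)[sr si]; exact: CC_of_smooth. Qed.

Lemma smooth_vec_CC_dvec (U : set (R * R)) n (F : R * R -> 'rV[C]_n) k v j :
  smooth_vec U F -> CC k U (fun y => dvec F y v 0 j).
Proof.
move=> /(_ j)[sr si]; under eq_fun do rewrite mxE.
by apply: CC_of_smooth => m; [exact: (sr m.+1 v).2|exact: (si m.+1 v).2].
Qed.

Lemma CC_det3 k (U : set (R * R)) (u v w : R * R -> V3) :
  (forall j, CC k U (fun x => u x 0 j)) ->
  (forall j, CC k U (fun x => v x 0 j)) ->
  (forall j, CC k U (fun x => w x 0 j)) ->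
  CC k U (fun x => det3 (u x) (v x) (w x)).
Proof.
move=> hu hv hw.
have minor i j : CC k U (fun x => v x 0 i * w x 0 j - v x 0 j * w x 0 i).
  by apply: CC_add; last apply: CC_opp; apply: CC_mul.
apply: CC_add; last by apply: CC_mul.
by apply: CC_add; last apply: CC_opp; apply: CC_mul.
Qed.

Lemma dvec_lin (U : set (R * R)) n (F : R * R -> 'rV[C]_n) x v : open U ->
  smooth_vec U F -> U x ->
  dvec F x v = rc v.1 *: dvec F x (1, 0) + rc v.2 *: dvec F x (0, 1).
Proof.
move=> oU sF Ux; apply/rowP => j; have [sr si] := sF j.
have lin (a b r1 r2 i1 i2 : R) : to_Cplx (a * r1 + b * r2, a * i1 + b * i2) =
    rc a * to_Cplx (r1, i1) + rc b * to_Cplx (r2, i2) :> C.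
  by apply: eq_re_im; rewrite ?(reD, imD) ?(reM, imM) /= ?mul0r ?subr0 ?addr0.
rewrite [LHS]mxE [RHS]mxE [in X in X + _]mxE [in X in _ + X]mxE.
rewrite [dvec _ _ (1, 0) _ _]mxE [dvec _ _ (0, 1) _ _]mxE -lin.
congr (to_Cplx (_, _)); first exact: smooth_derive_lin sr Ux.
exact: smooth_derive_lin si Ux.
Qed.

Lemma near_eq_dvec n (F G : R * R -> 'rV[C]_n) x v : {near x, F =1 G} ->
  dvec F x v = dvec G x v.
Proof.
move=> FG; apply/rowP => j; rewrite !mxE; congr (to_Cplx (_, _)).
  by apply: near_eq_derive; apply: filterS FG => y ->.
by apply: near_eq_derive; apply: filterS FG => y ->.
Qed.

Lemma dvec_comp_holomorphic (U : set (R * R)) n (F : R * R -> 'rV[C]_n)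
    (h : C -> C) (t : C) x v : open U -> smooth_vec U F ->
  U (of_Cplx (h (to_Cplx x))) -> is_dC (h \o @to_Cplx R) x v (t * to_Cplx v) ->
  dvec (fun y => F (of_Cplx (h (to_Cplx y)))) x v =
    dvec F (of_Cplx (h (to_Cplx x))) (of_Cplx (t * to_Cplx v)).
Proof.
move=> oU sF Ux ht; apply/rowP => j; have [sr si] := sF j; rewrite !mxE.
by congr (to_Cplx (_, _)); exact: (derive_comp_holomorphic oU).
Qed.

(** The scalar factor is itself a coordinate of [F]: this is the shape of the relation between two
    affine charts. *)
Lemma dvec_scale (U W : set (R * R)) n (F G : R * R -> 'rV[C]_n) (j : 'I_n)
    x v :
  smooth_vec U F -> smooth_vec W G -> U x -> W x ->
  {near x, F =1 fun y => F y 0 j *: G y} ->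
  dvec F x v = F x 0 j *: dvec G x v + dvec F x v 0 j *: G x.
Proof.
move=> sF sG Ux Wx FG; apply/rowP => m.
have dF i := @smooth_vec_is_dC U n F x v i sF Ux.
have dG i := @smooth_vec_is_dC W n G x v i sG Wx.
have := near_is_dC _ (is_dCM (dF j) (dG m)).
move=> /(_ (fun y => F y 0 m)) h.
have {}h : is_dC (fun y => F y 0 m) x v
    (dvec F x v 0 j * G x 0 m + F x 0 j * dvec G x v 0 m).
  by apply: h; apply: filterS FG => y {2}->; rewrite mxE.
rewrite (is_dC_val (dF m)) -(is_dC_val h).
have E (k l : C) (a b : 'rV[C]_n) :
    (k *: a + l *: b) 0 m = k * a 0 m + l * b 0 m.
  by rewrite !mxE.
by rewrite E addrC.
Qed.

End Jet.

(** * Affine charts of the projective plane *)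

Section AffineCharts.
Variable R : realType.
Local Notation C := (Cplx R).
Local Notation V3 := 'rV[Cplx R]_3.
Implicit Types (l : CP2 R) (i j : 'I_3).

Lemma vline_scale (k : C) (v : V3) : k != 0 -> <[k *: v]>%VS = <[v]>%VS.
Proof.
move=> k0; apply/eqP; rewrite eqEdim -memvE memvZ ?memv_line//=.
by rewrite !dim_vline scaler_eq0 (negbTE k0).
Qed.

Lemma generator_neq0 l : generator l != 0.
Proof. by rewrite /generator vpick0 -dimv_eq0 (eqP (valP l)). Qed.

Lemma affine_dom_cover l : exists i, affine_dom i l.
Proof.
apply/existsP; apply: contraNT (generator_neq0 l) => /existsPn h.
by apply/eqP/rowP => i; rewrite mxE; have /negPn/eqP := h i.
Qed.

Lemma CP2_line l : val l = <[generator l]>%VS.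
Proof.
apply/esym/eqP; rewrite eqEdim -memvE memv_pick /=.
by rewrite dim_vline generator_neq0 (eqP (valP l)).
Qed.

Lemma affine_diag i l : affine_dom i l -> affine i l 0 i = 1.
Proof. by move=> li; rewrite mxE mulVf. Qed.

Lemma affine_line i l : affine_dom i l -> val l = <[affine i l]>%VS.
Proof.
move=> li; by rewrite CP2_line /affine vline_scale// invr_eq0.
Qed.

Lemma affine_change i j l : affine_dom j l ->
  affine i l = affine i l 0 j *: affine j l.
Proof. by move=> lj; rewrite [X in X *: _]mxE scalerA mulfK. Qed.

Lemma hopf_affine i l (z : S5 R) : affine_dom i l ->
  val z = val z 0 i *: affine i l -> hopf z = l.
Proof.
move=> li zE; apply/val_inj; rewrite /= (affine_line li).
have z0 : val z 0 i != 0.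
  have := hopf_subproof z; rewrite dim_vline; case: eqVneq => // vz0 _.
  by apply/eqP => c0; move: vz0; rewrite zE c0 scale0r eqxx.
by rewrite zE vline_scale.
Qed.

End AffineCharts.

(** * The determinant of the 1-jet of an affine representative *)

Section NormalizedLifts.
Variables (R : realType) (M : riemannSurface R) (f : M -> CP2 R).
Local Notation C := (Cplx R).
Local Notation V3 := 'rV[Cplx R]_3.
Implicit Types (phi psi : chart R M) (i j : 'I_3) (p q : M) (z : V3).

Hypothesis f_imm : immersion f.
Hypothesis f_real : forall p, ~ complex_point f p.

Definition coord_expr phi i : R * R -> V3 := in_coord phi (@affine R i \o f).

Definition coord_dom phi i : set (R * R) :=
  coord_range phi `&` in_coord phi f @^-1` @affine_dom R i.

Lemma open_coord_range phi : open (coord_range phi).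
Proof.
have : open (@to_Cplx R @^-1` crange phi); last exact.
by apply: open_comp => [x _|]; [exact: to_Cplx_continuous|exact: crange_open].
Qed.

Lemma in_coord_continuous phi (T : topologicalType) (g : M -> T) x :
  coord_range phi x -> {for cinv phi (to_Cplx x), continuous g} ->
  {for x, continuous (in_coord phi g)}.
Proof.
move=> xr gx; have tx := @to_Cplx_continuous R x.
exact: (cvg_comp _ _ (cvg_comp _ _ tx (cinv_continuous xr)) gx).
Qed.

Lemma open_coord_dom phi i : open (coord_dom phi i).
Proof.
rewrite openE => x [xr xi]; apply: filterI.
  by apply: open_nbhs_nbhs; split; [exact: open_coord_range|].
have of1 := (f_imm.1 i).1.
have nM : nbhs (cinv phi (to_Cplx x)) (f @^-1` @affine_dom R i).
  exact: open_nbhs_nbhs.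
have h := in_coord_continuous (g := id) xr (fun A => id).
exact: (h _ nM).
Qed.

Lemma smooth_coord_expr phi i : atlas M phi ->
  smooth_vec (coord_dom phi i) (coord_expr phi i).
Proof. by move=> aphi; exact: (f_imm.1 i).2. Qed.

Lemma charts_at_coord p phi i : charts_at f p phi i ->
  coord_dom phi i (of_Cplx (cmap phi p)) /\
  coord_expr phi i (of_Cplx (cmap phi p)) = affine i (f p).
Proof.
move=> [_ pphi pi]; rewrite /coord_dom /coord_range /coord_expr /in_coord /=.
by rewrite to_CplxK cmapK//; do !split => //; exact: cmap_range.
Qed.

Lemma coord_charts_at phi i x : atlas M phi -> coord_dom phi i x ->
  charts_at f (cinv phi (to_Cplx x)) phi i /\
  of_Cplx (cmap phi (cinv phi (to_Cplx x))) = x.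
Proof.
move=> aphi [xr xi]; rewrite cinvK// of_CplxK; split=> //.
by split => //; exact: cinv_dom.
Qed.

Lemma charts_at_exist p : exists phi i, charts_at f p phi i.
Proof.
have [phi aphi pphi] := atlas_cover p; have [i pi] := affine_dom_cover (f p).
by exists phi, i.
Qed.

Definition jet_det phi i p : C :=
  det3 (affine i (f p)) (differential f phi i p (1, 0))
    (differential f phi i p (0, 1)).

(** If it vanished, the two partial derivatives would be proportional over the complex numbers.
    Injectivity forces the factor to be non-real, so the real image of the differential would be a
    whole complex line, and [p] a complex point. *)
Lemma jet_det_neq0 p phi i : charts_at f p phi i -> jet_det phi i p != 0.
Proof.
move=> hp; have [xW gx] := charts_at_coord hp; have [aphi pphi pi] := hp.
have inj := f_imm.2 p phi i hp.
set x := of_Cplx (cmap phi p) in xW gx.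
have oW : open (coord_dom phi i) by exact: open_coord_dom.
 have sW := @smooth_coord_expr phi i aphi.
have [d dd] : exists d, d = differential f phi i p.
  by exists (differential f phi i p).
have dlin v : d v = rc v.1 *: d (1, 0) + rc v.2 *: d (0, 1).
  by rewrite dd; exact: (@dvec_lin R _ _ _ x v oW sW xW).
have dz : d 0 = 0.
  have rz : rc (0 : R) = 0 by apply: eq_re_im.
  have E (a b : V3) : rc 0 *: a + rc 0 *: b = 0 by rewrite rz !scale0r addr0.
  exact: etrans (dlin 0) (E _ _).
rewrite -dd in inj.
have d0 v : v != 0 -> d v != 0.
  move=> v0; apply/eqP => dv; case/eqP: v0; apply: inj.
  exact: etrans dv (esym dz).
have e1 : (1, 0) != 0 :> R * R by apply/eqP => -[/eqP]; rewrite oner_eq0.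
(* The [i]-th entry of the [i]-th affine chart is constantly 1 near [x]. *)
have di v : d v 0 i = 0.
  have h : is_dC (fun y => coord_expr phi i y 0 i) x v (d v 0 i).
    by rewrite dd; exact: (@smooth_vec_is_dC R _ _ _ x v i sW xW).
  have h1 : is_dC (fun y => coord_expr phi i y 0 i) x v 0.
    apply: near_is_dC (is_dC_cst 1 x v).
    apply: filterS (open_nbhs_nbhs (conj oW xW)) => y [_ yi].
    by rewrite /coord_expr /in_coord /= affine_diag.
  by rewrite (is_dC_val h) -(is_dC_val h1).
rewrite /jet_det -dd; apply/eqP.
move=> /(det3_eq0 (affine_diag pi) (di _) (di _) (d0 _ e1))[m dm].
have dE v : d v = (rc v.1 + rc v.2 * m) *: d (1, 0).
  by rewrite scalerDl -scalerA -dm; exact: dlin.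
(* For a real [m] the nonzero vector [(- re m, 1)] would lie in the kernel of [d]. *)
have m0 : im m != 0.
  apply/eqP => m0; have : d (- re m, 1) = 0.
    rewrite dE (_ : _ + _ = 0) ?scale0r//.
    apply: eq_re_im; rewrite ?(reD, imD) ?(reM, imM) /= ?mul1r ?mul0r ?subr0.
      by rewrite addNr.
    by rewrite m0 !addr0.
  by apply/eqP/d0; apply/eqP => -[_ /eqP]; rewrite oner_eq0.
apply: (f_real (p := p)); exists phi, i; split=> //.
exists (d (1, 0)); first exact: d0.
rewrite -dd.
apply/seteqP; split=> [_ [v _ <-]|_ [v _ <-]] /=.
  by exists (rc v.1 + rc v.2 * m) => //; rewrite -dE.
(* The real coordinates of the complex number [v] in the basis [1], [m]. *)
exists (re v - im v / im m * re m, im v / im m) => //.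
rewrite dE; congr (_ *: _).
apply: eq_re_im; rewrite ?(reD, imD) ?(reM, imM) /= ?mul0r ?subr0 ?addr0 ?add0r.
  by rewrite subrK.
by rewrite mulfVK.
Qed.

(** Passing from one affine chart to another is a change of lift, so [det3_gauge] applies with the
    transition function as factor. *)
Lemma jet_det_affine p phi i j : charts_at f p phi i -> charts_at f p phi j ->
  jet_det phi i p = affine i (f p) 0 j ^+ 3 * jet_det phi j p.
Proof.
move=> hi hj; have [xWi gi] := charts_at_coord hi.
have [xWj gj] := charts_at_coord hj; have [aphi _ _] := hi.
set x := of_Cplx (cmap phi p) in xWi xWj gi gj.
have FG : {near x, coord_expr phi i =1
    fun y => coord_expr phi i y 0 j *: coord_expr phi j y}.
  have nj := open_nbhs_nbhs (conj (@open_coord_dom phi j) xWj).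
  apply: filterS nj => y [_ yj].
  exact: affine_change.
have dE v := @dvec_scale R _ _ _ _ _ j x v (@smooth_coord_expr phi i aphi)
  (@smooth_coord_expr phi j aphi)  xWi xWj FG.
have [m dm] : exists m : R * R -> C, forall v, differential f phi i p v =
    affine i (f p) 0 j *: differential f phi j p v + m v *: affine j (f p).
  exists (fun v => dvec (coord_expr phi i) x v 0 j) => v.
  by rewrite -gi -gj; exact: dE.
have aE : affine i (f p) = affine i (f p) 0 j *: affine j (f p).
  by apply: affine_change; case: hj.
rewrite /jet_det; move: dm aE.
move: (differential f phi i p) (differential f phi j p) => d d' dm.
move: (affine i (f p) 0 j) dm => k dm aE.
by rewrite !dm aE det3_gauge.
Qed.

End NormalizedLifts.

(** * A continuous cube root of directions and the cube roots of unity *)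

Section CubeRoots.
Variable R : realType.
Local Notation C := (Cplx R).

(* On the right half-plane, a continuous branch of [w |-> (w / |w|)^(1/3)]. *)
Definition cbrt_dir (w : C) : C :=
  let t := atan (im w / re w) / 3 in to_Cplx (cos t, sin t).

Lemma cbrt_dir_cube (w : C) : 0 < re w ->
  exists2 r : R, 0 < r & cbrt_dir w ^+ 3 = rc r * w.
Proof.
move=> w0; set u := im w / re w; set a := atan u.
have ca : 0 < cos a.
  by rewrite cos_atan invr_gt0 sqrtr_gt0 ltr_wpDr ?sqr_ge0.
have sa : sin a = u * cos a.
  by rewrite -{1}(atanK u) /tan -/a divfK// gt_eqF.
(* This is the inverse of the modulus of [w], since [a] is the argument of [w]; the rest is the
   triple-angle formulas for [a / 3]. *)
exists (cos a / re w); first exact: divr_gt0.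
rewrite /cbrt_dir -/u -/a; set t := a / 3.
have at3 : a = t + t + t by rewrite /t; field.
have c3 : cos a = cos t ^+ 3 - cos t * sin t ^+ 2 *+ 3.
  by rewrite at3 !(cosD, sinD); ring.
have s3 : sin a = cos t ^+ 2 * sin t *+ 3 - sin t ^+ 3.
  by rewrite at3 !(cosD, sinD); ring.
rewrite exprS expr2; apply: eq_re_im; rewrite ?(reM, imM) /= !mul0r ?subr0 ?addr0.
  by rewrite divfK ?gt_eqF// c3; ring.
have -> : cos a / re w * im w = sin a by rewrite sa /u; ring.
by rewrite s3; ring.
Qed.

Lemma cbrt_dir_continuous (w : C) : 0 < re w -> {for w, continuous cbrt_dir}.
Proof.
move=> w0.
have cr : re z @[z --> w] --> re w by exact: (@cvg_re _ _ (nbhs w) _ id w cvg_id).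
have ci : im z @[z --> w] --> im w by exact: (@cvg_im _ _ (nbhs w) _ id w cvg_id).
have cu : im z / re z @[z --> w] --> im w / re w.
  have w1 : re w != 0 by rewrite gt_eqF.
  exact: (cvgM ci (cvgV w1 cr)).
have ct : atan (im z / re z) / 3 @[z --> w] --> atan (im w / re w) / 3.
  have ca : atan (im z / re z) @[z --> w] --> atan (im w / re w).
    exact: (cvg_comp _ _ cu (@continuous_atan _ _)).
  exact: cvgMr_tmp ca.
have hc : cos (atan (im z / re z) / 3) @[z --> w] --> cos (atan (im w / re w) / 3).
  exact: (cvg_comp _ _ ct (@continuous_cos _ _)).
have hs : sin (atan (im z / re z) / 3) @[z --> w] --> sin (atan (im w / re w) / 3).
  exact: (cvg_comp _ _ ct (@continuous_sin _ _)).
exact: (@cvg_to_Cplx R _ (nbhs w) _ _ _ (_, _) hc hs).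
Qed.

Lemma cube_root_unity : exists o : C,
  [/\ o ^+ 3 = 1, `|o| = 1, forall k l : 'I_3, o ^+ k = o ^+ l -> k = l &
      forall u : C, u ^+ 3 = 1 -> exists k : 'I_3, u = o ^+ k].
Proof.
pose o : C := (-1 + sqrtC (-3)) / 2.
have n2 : 2 != 0 :> C by rewrite pnatr_eq0.
have o2 : o ^+ 2 + o + 1 = 0.
  have := sqrtCK (-3 : C); rewrite /o; move: (sqrtC _) => s s2.
  have -> : ((-1 + s) / 2) ^+ 2 + (-1 + s) / 2 + 1 = (s ^+ 2 + 3) / 4 :> C.
    by field.
  by rewrite s2 addNr mul0r.
have o3 : o ^+ 3 = 1.
  apply/subr0_eq; rewrite (_ : _ - 1 = (o - 1) * (o ^+ 2 + o + 1)); last by ring.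
  by rewrite o2 mulr0.
have on : `|o| = 1.
  by apply/eqP; rewrite -(@pexpr_eq1 _ _ 3)// -normrX o3 normr1.
have o0 : o != 0 by rewrite -normr_eq0 on oner_eq0.
have o1 : o != 1.
  apply/eqP => o1; move/eqP: o2; rewrite o1 expr1n.
  by rewrite (_ : 1 + 1 + 1 = 3); [rewrite pnatr_eq0|ring].
have oo : o ^+ 2 != o.
  rewrite expr2 -subr_eq0 -[X in _ - X]mulr1 -mulrBr.
  by rewrite mulf_neq0// subr_eq0.
have o21 : o ^+ 2 != 1.
  by apply/eqP => h; move: o3 o1; rewrite exprS h mulr1 => ->; rewrite eqxx.
exists o; split=> //.
  have n1 : 1 <> o by apply/eqP; rewrite eq_sym.
  have n1' : o <> 1 by apply/eqP.
  have n2' : 1 <> o ^+ 2 by apply/eqP; rewrite eq_sym.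
  have n2'' : o ^+ 2 <> 1 by apply/eqP.
  have n3 : o <> o ^+ 2 by apply/eqP; rewrite eq_sym.
  have n3' : o ^+ 2 <> o by apply/eqP.
  by apply: I3_ind; apply: I3_ind => // h; exfalso;
    first [exact: (n1 h)|exact: (n1' h)|exact: (n2' h)|exact: (n2'' h)
          |exact: (n3 h)|exact: (n3' h)].
move=> u u3; have : (u - 1) * ((u - o) * (u - o ^+ 2)) = 0.
  (* An identity valid for all [u] and [o], arranged so that [u3], [o3] and [o2] annihilate the
     right-hand side. *)
  have -> : (u - 1) * ((u - o) * (u - o ^+ 2)) =
      u ^+ 3 - o ^+ 3 - (o ^+ 2 + o + 1) * (u ^+ 2 - o * u).
    by ring.
  by rewrite u3 o3 o2; ring.
move/eqP; rewrite !mulf_eq0 !subr_eq0 => /or3P[] /eqP ->.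
- by exists 0.
- by exists 1.
- by exists 2%:R.
Qed.

Lemma cvg_mxP (T : Type) (F : set_system T) {FF : Filter F} m n
    (g : T -> 'M[C]_(m, n)) (l : 'M[C]_(m, n)) :
  (forall i j, g x i j @[x --> F] --> l i j) -> g x @[x --> F] --> l.
Proof.
move=> gl A [P Pl PA]; apply: filterS PA _.
have : \forall x \near F, forall ij : 'I_m * 'I_n, P ij.1 ij.2 (g x ij.1 ij.2).
  by apply: filter_forall => -[i j]; exact: gl (Pl i j).
by apply: filterS => x h i j; exact: (h (i, j)).
Qed.

End CubeRoots.

(** * Normalized values: independence of charts and smoothness *)

Section NormalizedLiftTheory.
Variables (R : realType) (M : riemannSurface R) (f : M -> CP2 R).
Local Notation C := (Cplx R).
Local Notation V3 := 'rV[Cplx R]_3.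
Implicit Types (phi psi : chart R M) (i j : 'I_3) (p q : M) (z : V3).

Hypothesis f_imm : immersion f.
Hypothesis f_real : forall p, ~ complex_point f p.

(* The transition map [h] has a complex derivative [t], so the real Jacobian
   between the two charts is a similarity of determinant [|t|^2]. *)
Lemma jet_det_chart p phi psi i : charts_at f p phi i -> charts_at f p psi i ->
  exists2 s : C, 0 <= s & jet_det f phi i p = s * jet_det f psi i p.
Proof.
move=> hphi hpsi; have [xW gx] := charts_at_coord hphi.
have [yW gy] := charts_at_coord hpsi.
have [aphi pphi pi] := hphi; have [apsi ppsi _] := hpsi.
set x := of_Cplx (cmap phi p) in xW gx; set y := of_Cplx (cmap psi p) in yW gy.
have oW : open (coord_dom f psi i) by exact: open_coord_dom.
have sW := @smooth_coord_expr _ _ _ f_imm psi i apsi.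
pose h (w : C) : C := cmap psi (cinv phi w).
have xE : to_Cplx x = cmap phi p by rewrite to_CplxK.
have hx : of_Cplx (h (to_Cplx x)) = y by rewrite xE /h cmapK.
have [t ht] : exists t : C, forall v, is_dC (h \o @to_Cplx R) x v (t * to_Cplx v).
  apply: holomorphic_is_dC; rewrite xE.
  apply: (atlas_compatible aphi apsi); first exact: cmap_range.
  by rewrite cmapK.
have cx : {for x, continuous (in_coord phi id)}.
  by apply: in_coord_continuous => //; exact: xW.1.
have near_h : {near x, (fun u => coord_expr f psi i (of_Cplx (h (to_Cplx u)))) =1
    coord_expr f phi i}.
  have nd : nbhs (in_coord phi id x) (cdom psi).
    rewrite /in_coord xE cmapK//.
    by apply: open_nbhs_nbhs; split; [exact: cdom_open|].
  have nx : nbhs x (in_coord phi id @^-1` cdom psi) by exact: cx.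
  apply: filterS nx => u pu.
  by rewrite /coord_expr /in_coord /h /= to_CplxK cmapK.
have dE v : differential f phi i p v =
    differential f psi i p (of_Cplx (t * to_Cplx v)).
  have l1 : differential f phi i p v = dvec (coord_expr f phi i) x v by [].
  apply: etrans l1 (etrans (esym (near_eq_dvec v near_h)) _).
  have l2 := @dvec_comp_holomorphic R _ _ _ h t x v oW sW.
  by rewrite hx in l2; exact: l2 yW (ht v).
have dlin v : differential f psi i p v = rc v.1 *: differential f psi i p (1, 0)
    + rc v.2 *: differential f psi i p (0, 1).
  exact: (@dvec_lin R _ _ _ y v oW sW yW).
exists (rc (re t ^+ 2 + im t ^+ 2)).
  by rewrite /rc ler0c addr_ge0// sqr_ge0.
have e1 : of_Cplx (t * to_Cplx (1, 0)) = (re t, im t).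
  by congr pair; rewrite ?reM ?imM /= ?mulr1 ?mulr0 ?subr0 ?add0r.
have e2 : of_Cplx (t * to_Cplx (0, 1)) = (- im t, re t).
  by congr pair; rewrite ?reM ?imM /= ?mulr1 ?mulr0 ?sub0r ?addr0.
rewrite /jet_det !dE e1 e2 (dlin (re t, im t)) (dlin (- im t, re t)).
move: (differential f psi i p (1, 0)) (differential f psi i p (0, 1)) => d1 d2.
have -> : rc (- im t, re t).1 = - rc (im t) by exact: rmorphN.
by rewrite det3_rotate /= /rc rmorphD !rmorphXn.
Qed.

Definition sqnorm z : C := \sum_j `|z 0 j| ^+ 2.

Lemma sqnormZ (c : C) z : sqnorm (c *: z) = `|c| ^+ 2 * sqnorm z.
Proof.
rewrite /sqnorm mulr_sumr; apply: eq_bigr => j _.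
by rewrite mxE normrM exprMn.
Qed.

Lemma sqnorm_affine_gt0 i p : affine_dom i (f p) -> 0 < sqnorm (affine i (f p)).
Proof.
move=> pi; rewrite /sqnorm (bigD1 i)//= affine_diag// normr1 expr1n.
by rewrite ltr_pwDl// sumr_ge0// => j _; rewrite exprn_ge0.
Qed.

(** By [det3_gauge] the quantity in the last clause is the determinant of the frame of any
    differentiable lift with value [z] at [p]. Being positive in [Cplx R] includes being real. *)
Definition normalized_at phi i p z : Prop :=
  [/\ z = z 0 i *: affine i (f p), sqnorm z = 1 &
      0 < z 0 i ^+ 3 * jet_det f phi i p].

(* The unit vectors over [f p] which make the frame (lift, dlift) positive:
   they are exactly three, permuted by the cube roots of unity, because a change
   of lift by a factor [c] multiplies the determinant by [c ^+ 3]. *)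
Definition normalized p z : Prop :=
  exists phi i, charts_at f p phi i /\ normalized_at phi i p z.

(** The affine index is changed first, inside the chart [psi]: the cube of the transition factor
    turns the cube of [z 0 j] into that of [z 0 i]. Changing the chart then costs a factor that is
    nonnegative by [jet_det_chart] and nonzero because the determinants are. *)
Lemma normalizedP p phi i z : charts_at f p phi i ->
  normalized p z <-> normalized_at phi i p z.
Proof.
move=> hp; split=> [|h]; last by exists phi, i.
move=> [psi [j [hq [zE z1 zD]]]].
have [aphi pphi pi] := hp; have [apsi ppsi pj] := hq.
have hqi : charts_at f p psi i by [].
have aE := affine_change j pi.
have zi : z 0 i = z 0 j * affine j (f p) 0 i by rewrite {1}zE mxE.
have zD' : 0 < z 0 i ^+ 3 * jet_det f psi i p.
  by rewrite zi exprMn -mulrA -(jet_det_affine f_imm hq hqi).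
split; [by rewrite zi -scalerA -aE|exact: z1|].
have [s s0 sE] := jet_det_chart hp hqi.
have {}s0 : 0 < s.
  rewrite lt0r s0 andbT; apply/eqP => s00.
  by have := jet_det_neq0 f_imm f_real hp; rewrite sE s00 mul0r eqxx.
by rewrite sE mulrCA mulr_gt0.
Qed.

Definition coord_det phi i (x : R * R) : C :=
  det3 (coord_expr f phi i x) (dvec (coord_expr f phi i) x (1, 0))
    (dvec (coord_expr f phi i) x (0, 1)).

Lemma jet_detE p phi i : charts_at f p phi i ->
  jet_det f phi i p = coord_det phi i (of_Cplx (cmap phi p)).
Proof. by move=> hp; rewrite /jet_det /coord_det (charts_at_coord hp).2. Qed.

Lemma CC_coord_det k phi i : atlas M phi ->
  CC k (coord_dom f phi i) (coord_det phi i).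
Proof.
move=> aphi; have sW := @smooth_coord_expr _ _ _ f_imm phi i aphi.
apply: CC_det3 => j; first exact: smooth_vec_CC.
  exact: smooth_vec_CC_dvec.
exact: smooth_vec_CC_dvec.
Qed.

Lemma CC_coord_sqnorm k phi i : atlas M phi ->
  CC k (coord_dom f phi i) (fun x => sqnorm (coord_expr f phi i x)).
Proof.
move=> aphi; have sW := @smooth_coord_expr _ _ _ f_imm phi i aphi.
have aux j : CC k (coord_dom f phi i)
      (fun x => `|coord_expr f phi i x 0 j| ^+ 2).
  under eq_fun do rewrite normCK.
  by apply: CC_mul; last apply: CC_conj; exact: smooth_vec_CC.
exact: CC_sum.
Qed.

(* With [z = c *: a] normalized, [(c^3 D)^2 = |c|^6 |D|^2] is the relation
   [c^6 = conj D / (D |a|^6)], whose right-hand side is smooth. *)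
Lemma normalized_at_root phi i p z : charts_at f p phi i ->
  normalized_at phi i p z ->
  z 0 i ^+ 6 = Num.conj (jet_det f phi i p) *
    (jet_det f phi i p * sqnorm (affine i (f p)) ^+ 3)^-1.
Proof.
move=> hp [zE z1 zD]; set c := z 0 i; set D := jet_det f phi i p.
set S := sqnorm (affine i (f p)).
have D0 : D != 0 by exact: jet_det_neq0 hp.
have S0 : S != 0 by rewrite gt_eqF//; apply: sqnorm_affine_gt0; case: hp.
have cS : c * Num.conj c * S = 1 by rewrite -normCK -sqnormZ -zE.
have cD : c ^+ 3 * D = Num.conj c ^+ 3 * Num.conj D.
  have : Num.conj (c ^+ 3 * D) = c ^+ 3 * D.
    by apply: conj_Creal; rewrite realE ltW.
  by rewrite rmorphM rmorphXn => <-.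
apply: (@mulIf _ (D * S ^+ 3)); first by rewrite mulf_neq0// expf_neq0.
rewrite mulfVK; last by rewrite mulf_neq0// expf_neq0.
have -> : c ^+ 6 * (D * S ^+ 3) = c ^+ 3 * S ^+ 3 * (c ^+ 3 * D) by ring.
rewrite cD.
have -> : c ^+ 3 * S ^+ 3 * (Num.conj c ^+ 3 * Num.conj D) =
  (c * Num.conj c * S) ^+ 3 * Num.conj D by ring.
by rewrite cS expr1n mul1r.
Qed.

(** Near each point an affine index [i] is fixed. The coordinate [Z y 0 i] is a continuous
    nonvanishing sixth root of a smooth function, hence smooth, and the other coordinates are its
    products with affine coordinates of [f]. *)
Lemma normalized_smooth phi (W : set (R * R)) (Z : R * R -> V3) :
  atlas M phi -> open W -> W `<=` coord_range phi ->
  (forall x, W x -> {for x, continuous Z}) ->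
  (forall x, W x -> normalized (cinv phi (to_Cplx x)) (Z x)) ->
  smooth_vec W Z.
Proof.
move=> aphi oW Wphi cZ nZ j.
suff key x : W x -> exists U, [/\ U x, smooth_on U (fun y => re (Z y 0 j)) &
    smooth_on U (fun y => im (Z y 0 j))].
  by split=> k; apply: Ck_local => x /key[U [Ux hr hi]]; exists U.
move=> Wx; have [i xi] := affine_dom_cover (f (cinv phi (to_Cplx x))).
pose U := W `&` coord_dom f phi i.
have oU : open U by apply: openI => //; exact: open_coord_dom.
have UW : U `<=` W by move=> y [].
have UD : U `<=` coord_dom f phi i by move=> y [].
have hy y : U y -> charts_at f (cinv phi (to_Cplx y)) phi i /\
    of_Cplx (cmap phi (cinv phi (to_Cplx y))) = y.
  by move=> [_ yD]; exact: coord_charts_at.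
have nzU y : U y -> normalized_at phi i (cinv phi (to_Cplx y)) (Z y).
  by move=> Uy; apply/normalizedP; [exact: (hy y Uy).1|apply: nZ; exact: UW].
have S0 y : U y -> sqnorm (coord_expr f phi i y) != 0.
  move=> Uy; rewrite gt_eqF//.
  apply: (sqnorm_affine_gt0 (p := cinv phi (to_Cplx y))).
  by case: (hy y Uy).1.
have D0 y : U y -> coord_det phi i y != 0.
  by move=> /hy[h e]; rewrite -{1}e -(jet_detE h); exact: jet_det_neq0 h.
have Zr y : U y -> Z y 0 i ^+ 6 = Num.conj (coord_det phi i y) *
    (coord_det phi i y * sqnorm (coord_expr f phi i y) ^+ 3)^-1.
  move=> Uy; have [h e] := hy y Uy.
  rewrite (normalized_at_root h (nzU y Uy)) (jet_detE h) e; exact: erefl.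
have cU k : CC k U (fun y => Z y 0 i).
  have DU := CC_sub UD (CC_coord_det k i aphi).
  have SU := CC_sub UD (CC_coord_sqnorm k i aphi).
  (* [CC_root] is stated for the exponent [n.+1], here 6. *)
  apply: (CC_root (n := 5) oU _ _ Zr).
  - move=> y /UW/cZ Zy.
    exact: (cvg_comp _ _ Zy (@coord_continuous _ _ _ _ _ _)).
  - move=> y Uy; apply/eqP => z0; have [_ _] := nzU y Uy.
    by rewrite z0 expr0n mul0r ltxx.
  apply: CC_mul; first exact: CC_conj.
  apply: CC_inv; last by apply: CC_mul => //; exact: CC_exp.
  by move=> y Uy; rewrite mulf_neq0 ?D0// expf_neq0// S0.
have ZE y : U y -> Z y 0 j = Z y 0 i * coord_expr f phi i y 0 j.
  move=> /nzU[zE _ _]; apply: etrans (congr1 (fun z : V3 => z 0 j) zE) _.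
  by rewrite mxE.
have sZ k : CC k U (fun y => Z y 0 i * coord_expr f phi i y 0 j).
  apply: CC_mul => //; apply: (CC_sub UD).
  by apply: smooth_vec_CC; exact: smooth_coord_expr.
exists U; split; first by split=> //; split; [exact: Wphi|exact: xi].
  by apply: (@CC_smooth R U _ _ oU sZ).1 => y /ZE ->.
by apply: (@CC_smooth R U _ _ oU sZ).2 => y /ZE ->.
Qed.

End NormalizedLiftTheory.

(** * Three continuous normalized lifts near a point *)

Section LocalFrames.
Variables (R : realType) (M : riemannSurface R) (f : M -> CP2 R).
Local Notation C := (Cplx R).
Local Notation V3 := 'rV[Cplx R]_3.
Implicit Types (phi : chart R M) (i : 'I_3) (p q : M) (z : V3).

Hypothesis f_imm : immersion f.
Hypothesis f_real : forall p, ~ complex_point f p.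

Lemma open_charts_at phi i : atlas M phi -> open [set q | charts_at f q phi i].
Proof.
move=> aphi.
have -> : [set q | charts_at f q phi i] = cdom phi `&` f @^-1` @affine_dom R i.
  by apply/seteqP; split=> q [] //=.
by apply: openI; [exact: cdom_open|exact: (f_imm.1 i).1].
Qed.

Lemma coord_continuousM phi i (F : R * R -> C) (G : M -> C) :
  atlas M phi -> CC 0 (coord_dom f phi i) F ->
  (forall q, charts_at f q phi i -> G q = F (of_Cplx (cmap phi q))) ->
  forall q, charts_at f q phi i -> {for q, continuous G}.
Proof.
move=> aphi cF GF q hq; have [xW _] := charts_at_coord hq.
have cq : {for q, continuous (cmap phi)} by apply: cmap_continuous; case: hq.
suff h : G q' @[q' --> q] --> G q by exact: h.
rewrite (GF q hq).
have h : F (of_Cplx (cmap phi q')) @[q' --> q] --> F (of_Cplx (cmap phi q)).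
  have h1 : of_Cplx (cmap phi q') @[q' --> q] --> of_Cplx (cmap phi q).
    exact: (cvg_comp _ _ cq (@of_Cplx_continuous R _)).
  exact: (cvg_comp _ _ h1 (cF _ xW)).
apply: near_cvg h.
have nq := open_nbhs_nbhs (conj (open_charts_at i aphi) hq).
by apply: filterS nq => q' hq'; rewrite GF.
Qed.

(** One factor [c] is constructed explicitly and the others are its multiples by cube roots of
    unity. Two normalized factors have a quotient of modulus 1 whose cube is positive, hence equal
    to 1, so there are no more. *)
Lemma local_frame p0 : exists (U : set M) (s : 'I_3 -> M -> V3),
  [/\ open U, U p0, forall k q, U q -> {for q, continuous (s k)},
      forall q z, U q -> normalized f q z <-> exists k, z = s k q &
      forall q, U q -> injective (s^~ q)].
Proof.
have [phi [i h0]] := charts_at_exist f p0; have [aphi _ _] := h0.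
have sW := @smooth_coord_expr _ _ _ f_imm phi i aphi.
pose D q := jet_det f phi i q; pose a q := affine i (f q).
pose S q := sqnorm (a q).
have D0 q : charts_at f q phi i -> D q != 0 by exact: jet_det_neq0.
have S0 q : charts_at f q phi i -> 0 < S q.
  by move=> [_ _ qi]; exact: sqnorm_affine_gt0.
have cD q : charts_at f q phi i -> {for q, continuous D}.
  apply: (coord_continuousM aphi (CC_coord_det f_imm 0 i aphi)) => q' hq'.
  exact: jet_detE hq'.
have cS q : charts_at f q phi i -> {for q, continuous S}.
  apply: (coord_continuousM aphi (CC_coord_sqnorm f_imm 0 i aphi)) => q' hq'.
  by rewrite (charts_at_coord hq').2.
have ca j q : charts_at f q phi i -> {for q, continuous (fun q' => a q' 0 j)}.
  apply: (coord_continuousM aphi (smooth_vec_CC 0 j sW)) => q' hq'.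
  by rewrite (charts_at_coord hq').2.
have DE q : D q = jet_det f phi i q by [].
have aE q : a q = affine i (f q) by [].
have SE q : S q = sqnorm (a q) by [].
clearbody S; clearbody D; clearbody a.
(* The cube of the factor must point along [Num.conj (D q)]. Comparison with the value at [p0] gives
   a [v] that is positive at [p0], so nearby it stays in the half-plane where [cbrt_dir] is
   continuous; the fixed cube root [g] of [Num.conj (D p0)] undoes the comparison. *)
pose v q := Num.conj (D q) * D p0.
pose U := [set q | charts_at f q phi i /\ 0 < re (v q)].
have cv q : charts_at f q phi i -> v q' @[q' --> q] --> v q.
  move=> hq; apply: cvgM; last exact: cvg_cst.
  by apply: cvg_conj; exact: cD.
have oU : open U.
  rewrite openE => q [hq vq]; apply: filterI.
    exact: open_nbhs_nbhs (conj (open_charts_at i aphi) hq).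
  have cr : re (v q') @[q' --> q] --> re (v q) by exact: cvg_re (cv q hq).
  exact: (cr _ (open_nbhs_nbhs (conj (@open_gt R 0) vq))).
have Up0 : U p0.
  split=> //; have v0 : 0 < v p0.
    by rewrite /v mulrC -normCK exprn_gt0// normr_gt0 D0.
  by have [r r0 ->] := gt0_rc v0.
pose g := 3.-root (Num.conj (D p0)).
have g3 : g ^+ 3 = Num.conj (D p0) by exact: rootCK.
clearbody g.
have g0 : g != 0.
  apply/eqP => g0; move/eqP: g3.
  by rewrite g0 expr0n eq_sym conjC_eq0 (negbTE (D0 _ h0)).
pose w q := g * cbrt_dir (v q).
have w3 q : U q -> exists2 r : R, 0 < r & w q ^+ 3 * D q = rc r.
  move=> [hq vq]; have [r r0 rE] := cbrt_dir_cube vq.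
  have P0 : 0 < `|D p0| ^+ 2 * `|D q| ^+ 2.
    by rewrite mulr_gt0// exprn_gt0// normr_gt0 D0.
  have [m m0 mE] := gt0_rc P0.
  exists (r * m); first exact: mulr_gt0.
  have mE' : rc m = D p0 * Num.conj (D p0) * (D q * Num.conj (D q)).
    by rewrite -mE !normCK.
  have -> : w q ^+ 3 = g ^+ 3 * cbrt_dir (v q) ^+ 3 by exact: exprMn.
  rewrite g3 rE rcM mE' /v.
  move: (Num.conj (D p0)) (Num.conj (D q)) (D p0) (D q) (rc r) => x1 x2 x3 x4 x5.
  by ring.
have w0 q : U q -> w q != 0.
  move=> Uq; have [r r0 rE] := w3 q Uq; apply/eqP => wq.
  by move: rE; rewrite wq expr0n mul0r => /eqP; rewrite eq_sym rc_eq0 gt_eqF.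
pose T q := `|w q| ^+ 2 * S q.
have T0 q : U q -> exists2 r : R, 0 < r & T q = rc r.
  move=> Uq; apply: gt0_rc; rewrite mulr_gt0 ?S0 ?exprn_gt0 ?normr_gt0 ?w0//.
  by case: Uq.
(* A positive rescaling to unit length, which leaves the sign of the determinant unchanged. *)
pose c q := w q * rc (Num.sqrt (re (T q)))^-1.
have c3 q : U q -> 0 < c q ^+ 3 * D q.
  move=> Uq; have [r r0 rE] := w3 q Uq; have [t t0 tE] := T0 q Uq.
  have -> : c q ^+ 3 * D q = rc (r * (Num.sqrt t)^-1 ^+ 3).
    rewrite /c tE reK exprMn mulrAC rE rcM; congr (_ * _).
    by rewrite /rc rmorphXn.
  by rewrite /rc ltcR mulr_gt0// exprn_gt0// invr_gt0 sqrtr_gt0.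
have cn q : U q -> `|c q| ^+ 2 * S q = 1.
  move=> Uq; have [t t0 tE] := T0 q Uq.
  rewrite /c normrM exprMn mulrAC -/(T q) tE reK norm_rc ger0_norm; last first.
    by rewrite invr_ge0 sqrtr_ge0.
  have -> : rc (Num.sqrt t)^-1 ^+ 2 = rc (t^-1).
    by rewrite /rc -rmorphXn exprVn sqr_sqrtr// ltW.
  by rewrite -rcM mulfV ?gt_eqF.
have [om [om3 omn ominj omall]] := cube_root_unity R.
have c0 q : U q -> c q != 0.
  move=> Uq; apply/eqP => cq; have /eqP := cn q Uq.
  by rewrite cq normr0 expr0n mul0r eq_sym oner_eq0.
have cc q : U q -> {for q, continuous c}.
  move=> Uq; have [hq vq] := Uq; have [t t0 tE] := T0 q Uq.
  have cw : w q' @[q' --> q] --> w q.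
    apply: cvgM; first exact: cvg_cst.
    exact: (cvg_comp _ _ (cv q hq) (cbrt_dir_continuous vq)).
  have cT : T q' @[q' --> q] --> T q.
    apply: cvgM; last exact: cS.
    by apply: cvg_expC; exact: cvg_norm cw.
  have crT : re (T q') @[q' --> q] --> re (T q) by exact: cvg_re cT.
  have cs : Num.sqrt (re (T q')) @[q' --> q] --> Num.sqrt (re (T q)).
    exact: (cvg_comp _ _ crT (@sqrt_continuous _ _)).
  have ci : (Num.sqrt (re (T q')))^-1 @[q' --> q] --> (Num.sqrt (re (T q)))^-1.
    by apply: cvgV => //; rewrite tE reK gt_eqF// sqrtr_gt0.
  exact: (cvgM cw (cvg_rc ci)).
exists U, (fun k q => (om ^+ k * c q) *: a q).
split; [exact: oU|exact: Up0| | |].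
- move=> k q Uq; have hq := Uq.1.
  have h : (om ^+ k * c q') *: a q' @[q' --> q] --> (om ^+ k * c q) *: a q.
    apply: cvg_mxP => i0 j; rewrite ord1 !mxE.
    under eq_fun do rewrite mxE.
    apply: cvgM; last exact: ca.
    by apply: cvgM; [exact: cvg_cst|exact: cc].
  exact: h.
- move=> q z Uq; have hq := Uq.1.
  have a1 : a q 0 i = 1 by rewrite aE; apply: affine_diag; case: hq.
  split=> [/(normalizedP f_imm f_real z hq)[]|[k ->]].
    rewrite -aE -DE => zE z1 zD.
    set b := z 0 i in zE zD.
    have bn : `|b| ^+ 2 * S q = 1 by rewrite SE -sqnormZ -zE.
    have u1 : `|b / c q| = 1.
      apply/eqP; rewrite -(@pexpr_eq1 _ _ 2)// normf_div expr_div_n.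
      have S0' : S q != 0 by rewrite gt_eqF// S0.
      rewrite -(mulfK S0' (`|b| ^+ 2)) bn -(mulfK S0' (`|c q| ^+ 2)) cn//.
      by rewrite divff// div1r invr_eq0.
    have u3 : (b / c q) ^+ 3 = 1.
      have : 0 < (b / c q) ^+ 3.
        rewrite expr_div_n -(mulfK (D0 q hq) (b ^+ 3)) mulrAC -mulrA -invfM.
        by rewrite divr_gt0// c3.
      by move=> /gtr0_norm <-; rewrite normrX u1 expr1n.
    have [k kE] := omall _ u3; exists k.
    by rewrite zE -/b -kE divfK// c0.
  have zi : ((om ^+ k * c q) *: a q) 0 i = om ^+ k * c q by rewrite mxE a1 mulr1.
  apply/(normalizedP f_imm f_real _ hq).
  split; rewrite ?zi -?aE -?DE.
  - by [].
  - by rewrite sqnormZ -SE normrM normrX omn expr1n mul1r cn.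
  - by rewrite exprMn -exprM mulnC exprM om3 expr1n mul1r c3.
- move=> q Uq k l /=; have hq := Uq.1.
  have a1 : a q 0 i = 1 by rewrite aE; apply: affine_diag; case: hq.
  move/(congr1 (fun z : V3 => z 0 i)); rewrite !mxE a1 !mulr1.
  by move/(mulIf (c0 q Uq))/ominj.
Qed.

End LocalFrames.

(** * Finite-sheeted coverings given by local sections *)

Section SheetedSpaces.
Variables (n : nat) (X M : topologicalType) (h : X -> M).

(** Local triviality expressed by sections that exhaust each fibre; openness of the sheets is a
    consequence in a Hausdorff space. *)
Definition frames_of_sections : Prop := forall p : M,
  exists (U : set M) (t : 'I_n -> M -> X),
    [/\ open U, U p,
        forall k q, U q -> {for q, continuous (t k)} /\ h (t k q) = q,
        forall x, U (h x) -> exists k, x = t k (h x) &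
        forall q, U q -> injective (t^~ q)].

Hypothesis X_haus : hausdorff_space X.
Hypothesis h_cont : continuous h.
Hypothesis h_frames : frames_of_sections.

Lemma near_neq (T : topologicalType) (f g : T -> X) x :
  {for x, continuous f} -> {for x, continuous g} -> f x <> g x ->
  \forall y \near x, f y <> g y.
Proof.
move=> cf cg /eqP fg; have := X_haus; rewrite open_hausdorff => /(_ _ _ fg).
move=> [[A B] /= [/set_mem Af /set_mem Bg] [oA oB /eqP AB0]].
have nA : \forall y \near x, A (f y) by exact: cf _ (open_nbhs_nbhs (conj oA Af)).
have nB : \forall y \near x, B (g y) by exact: cg _ (open_nbhs_nbhs (conj oB Bg)).
apply: filterS2 nA nB => y Ay By e.
have : (A `&` B) (f y) by split=> //; rewrite e.
by rewrite AB0.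
Qed.

(** Near a point of sheet [k], the Hausdorff property keeps [x] away from [t j (h x)] for every
    other [j]. Since the sections exhaust the fibre, [x] must be [t k (h x)]. *)
Lemma open_sheet (U : set M) (t : 'I_n -> M -> X) k : open U ->
  (forall k q, U q -> {for q, continuous (t k)} /\ h (t k q) = q) ->
  (forall x, U (h x) -> exists k, x = t k (h x)) ->
  (forall q, U q -> injective (t^~ q)) -> open (t k @` U).
Proof.
move=> oU ct exht injt; rewrite openE => _ [q Uq <-].
have hq : h (t k q) = q by exact: (ct k q Uq).2.
have nU : \forall x \near t k q, U (h x).
  by apply: h_cont; rewrite hq; exact: open_nbhs_nbhs.
have nj : \forall x \near t k q, forall j, j != k -> x <> t j (h x).
  apply: filter_forall => j; have [->|jk] := eqVneq j k.
    by apply: nearW.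
  have cj : {for t k q, continuous (t j \o h)}.
    apply: continuous_comp; first exact: h_cont.
    by rewrite hq; exact: (ct j q Uq).1.
  have ne : t k q <> (t j \o h) (t k q).
    by rewrite /= hq => /(injt q Uq) kj; rewrite kj eqxx in jk.
  have := @near_neq X id _ _ (fun A => id) cj ne.
  by apply: filterS => x xj _.
apply: filterS2 nU nj => x Ux xj; exists (h x) => //.
have [j xE] := exht x Ux; have [<- //|/xj[]] := eqVneq j k.
exact: xE.
Qed.

Lemma frames_covering_map : covering_map n h.
Proof.
split=> // y; have [U [t [oU Uy ct exht injt]]] := h_frames y.
exists U; split=> //; exists (fun k => t k @` U); split.
- by move=> k; exact: open_sheet.
- move=> k l _ _ [_ [[q Uq <-] [q' Uq' e]]].
  have qq : q' = q by rewrite -(ct l q' Uq').2 e (ct k q Uq).2.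
  by apply: (injt q Uq); rewrite -e qq.
- apply/seteqP; split=> [x Ux|x [k _ [q Uq <-]]].
    by have [k xE] := exht x Ux; exists k => //; exists (h x).
  by rewrite /preimage /= (ct k q Uq).2.
- move=> k; exists (t k); split=> //.
    by apply: continuous_in_subspaceT => q /set_mem /(ct k)[].
  by move=> u /(ct k)[].
Qed.

Section Clopen.
Variable B : set X.
Hypotheses (oB : open B) (oCB : open (~` B)).

(** Clopenness makes membership in [B] locally constant along each section, and finiteness gives one
    neighbourhood for all of them. *)
Lemma near_pattern (T : topologicalType) (t : 'I_n -> T -> X) p :
  (forall k, {for p, continuous (t k)}) ->
  \forall q \near p, forall k, B (t k q) <-> B (t k p).
Proof.
move=> ct; apply: filter_forall => k; have [Bk|nBk] := pselect (B (t k p)).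
  have nB : \forall q \near p, B (t k q).
    by exact: ct k _ (open_nbhs_nbhs (conj oB Bk)).
  by apply: filterS nB => q Bq; split.
have nB : \forall q \near p, (~` B) (t k q).
  by exact: ct k _ (open_nbhs_nbhs (conj oCB nBk)).
by apply: filterS nB => q nBq; split.
Qed.

Definition uniquely_in (p : M) : Prop :=
  exists2 x, h x = p /\ B x & forall x', h x' = p -> B x' -> x' = x.

Definition fibre_in (p : M) : Prop := forall x, h x = p -> B x.

Lemma uniquely_in_frame (U : set M) (t : 'I_n -> M -> X) q :
  (forall k q, U q -> {for q, continuous (t k)} /\ h (t k q) = q) ->
  (forall x, U (h x) -> exists k, x = t k (h x)) ->
  (forall q, U q -> injective (t^~ q)) -> U q ->
  uniquely_in q <-> exists2 k, B (t k q) & forall j, B (t j q) -> j = k.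
Proof.
move=> ct exht injt Uq; split=> [[x [hx Bx] xu]|[k Bk ku]].
  have Uhx : U (h x) by rewrite hx.
  have [k xE] := exht x Uhx; rewrite hx in xE; exists k; first by rewrite -xE.
  move=> j Bj; apply: (injt q Uq); rewrite /= -xE.
  by apply: xu => //; exact: (ct j q Uq).2.
exists (t k q); first by split=> //; exact: (ct k q Uq).2.
move=> x hx Bx; have Uhx : U (h x) by rewrite hx.
have [j xE] := exht x Uhx; rewrite hx in xE; rewrite xE in Bx *.
by rewrite (ku j Bx).
Qed.

Lemma fibre_in_frame (U : set M) (t : 'I_n -> M -> X) q :
  (forall k q, U q -> {for q, continuous (t k)} /\ h (t k q) = q) ->
  (forall x, U (h x) -> exists k, x = t k (h x)) -> U q ->
  fibre_in q <-> forall k, B (t k q).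
Proof.
move=> ct exht Uq; split=> [f k|f x hx]; first exact: f (ct k q Uq).2.
have Uhx : U (h x) by rewrite hx.
by have [k ->] := exht x Uhx; rewrite hx.
Qed.

Lemma near_uniquely_in p : \forall q \near p, uniquely_in q <-> uniquely_in p.
Proof.
have [U [t [oU Up ct exht injt]]] := h_frames p.
have np := near_pattern (fun k => (ct k p Up).1).
have nU : nbhs p U by exact: open_nbhs_nbhs.
apply: filterS2 np nU => q pq Uq.
rewrite (uniquely_in_frame ct exht injt Uq) (uniquely_in_frame ct exht injt Up).
split=> -[k Bk ku]; exists k; [exact/pq|move=> j /pq; exact: ku|exact/pq|].
by move=> j /pq; exact: ku.
Qed.

Lemma near_fibre_in p : \forall q \near p, fibre_in q <-> fibre_in p.
Proof.
have [U [t [oU Up ct exht injt]]] := h_frames p.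
have np := near_pattern (fun k => (ct k p Up).1).
have nU : nbhs p U by exact: open_nbhs_nbhs.
apply: filterS2 np nU => q pq Uq.
rewrite (fibre_in_frame ct exht Uq) (fibre_in_frame ct exht Up).
by split=> Bk k; apply/pq.
Qed.

(** The points are selected by choice; near [p] the selection coincides with the one local section
    lying in [B], which gives continuity. *)
Lemma uniquely_in_section : (forall p, uniquely_in p) ->
  exists2 s : M -> X, continuous s & forall p, h (s p) = p.
Proof.
move=> uB; have [s sP] : {s : M -> X & forall p, h (s p) = p /\ B (s p)}.
  apply: (@boolp.choice _ _ (fun p x => h x = p /\ B x)) => p.
  by have [x hx _] := uB p; exists x.
exists s => [p|p]; last exact: (sP p).1.
have [U [t [oU Up ct exht injt]]] := h_frames p.
have np := near_pattern (fun k => (ct k p Up).1).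
have nU : nbhs p U by exact: open_nbhs_nbhs.
have [k Bk ku] := (uniquely_in_frame ct exht injt Up).1 (uB p).
have sE q : U q -> (forall k, B (t k q) <-> B (t k p)) -> s q = t k q.
  move=> Uq pq; have [hs Bs] := sP q.
  have Uhs : U (h (s q)) by rewrite hs.
  have [j sj] := exht _ Uhs; rewrite hs in sj; rewrite sj.
  by rewrite (ku j)//; apply/pq; rewrite -sj.
suff cs : s q @[q --> p] --> s p by exact: cs.
rewrite (sE p Up)//; have ck : t k q @[q --> p] --> t k p := (ct k p Up).1.
by apply: near_cvg ck; apply: filterS2 np nU => q pq Uq; rewrite sE.
Qed.

End Clopen.

(** The equivalence makes both [P] and its complement open. *)
Lemma locally_invariant (P : M -> Prop) : connected [set: M] ->
  (forall p, \forall q \near p, P q <-> P p) -> forall p, P p -> forall q, P q.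
Proof.
move=> cM nP p Pp; suff -> : P = [set: M] by [].
have oP : open (P : set M).
  by rewrite openE => q Pq; apply: filterS (nP q) => r [_]; exact.
have oCP : open (~` (P : set M)).
  by rewrite openE => q Pq; apply: filterS (nP q) => r [rq _] /rq.
apply: cM; first by exists p.
  by exists P => //; rewrite setTI.
by exists P; rewrite ?setTI// -[P]setCK; exact: open_closedC.
Qed.

End SheetedSpaces.

Lemma three_sheeted_connected (X M : topologicalType) (h : X -> M) :
  connected [set: M] -> frames_of_sections 3 h ->
  (forall s : M -> X, continuous s -> ~ forall p, h (s p) = p) ->
  connected [set: X].
Proof.
move=> cM fr nosec B [x0 Bx0] [A oA BA] [K cK BK].
rewrite setTI in BA; rewrite setTI in BK.
have oB : open B by rewrite BA.
have oCB : open (~` B) by rewrite BK openC.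
have oCCB : open (~` ~` B) by rewrite setCK.
have nB p : ~ uniquely_in h B p.
  move=> uB; have [s cs hs] := uniquely_in_section fr oB oCB
    (locally_invariant cM (near_uniquely_in fr oB oCB) uB).
  exact: nosec cs hs.
have nCB p : ~ uniquely_in h (~` B) p.
  move=> uB; have [s cs hs] := uniquely_in_section fr oCB oCCB
    (locally_invariant cM (near_uniquely_in fr oCB oCCB) uB).
  exact: nosec cs hs.
(* Of the eight possible patterns on three points, [nB] excludes those with one point in [B] and
   [nCB] those with one point outside. *)
have all_or_none p : fibre_in h B p \/ fibre_in h (~` B) p.
  have [U [t [oU Up ct exht injt]]] := fr p.
  have u1 D := uniquely_in_frame D ct exht injt Up.
  have f1 D := fibre_in_frame D ct exht Up.
  have := nB p; have := nCB p; rewrite !u1 !f1; pose b k := B (t k p).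
  rewrite -/(exists2 k, ~ b k & forall j, ~ b j -> j = k).
  rewrite -/(exists2 k, b k & forall j, b j -> j = k).
  rewrite -/(forall k, b k) -/(forall k, ~ b k); move: b => b n1 n2.
  have [b0|b0] := pselect (b 0); have [b1|b1] := pselect (b 1);
    have [b2|b2] := pselect (b 2%:R); try (by left; exact: I3_ind);
    try (by right; exact: I3_ind); exfalso;
    first [by apply: n2; exists 0 => //; exact: I3_ind
      |by apply: n2; exists 1 => //; exact: I3_ind
      |by apply: n2; exists 2%:R => //; exact: I3_ind
      |by apply: n1; exists 0 => //; exact: I3_ind
      |by apply: n1; exists 1 => //; exact: I3_ind
      |by apply: n1; exists 2%:R => //; exact: I3_ind].
have fB : fibre_in h B (h x0) by case: (all_or_none (h x0)) => // /(_ x0 erefl).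
apply/seteqP; split=> // x _.
exact: (locally_invariant cM (near_fibre_in fr oB oCB) fB (h x)).
Qed.

(** * The total space of a finite-valued relation *)

Section TotalSpace.
Variables (n : nat) (M E : topologicalType) (N : M -> E -> Prop).

Definition total_space : topologicalType := set_type [set x : M * E | N x.1 x.2].

Definition total_base (x : total_space) : M := (val x).1.
Definition total_fibre (x : total_space) : E := (val x).2.

Lemma total_spaceP (x : total_space) : N (total_base x) (total_fibre x).
Proof. exact: set_mem (valP x). Qed.

Lemma total_val_continuous : continuous (val : total_space -> M * E).
Proof. exact: initial_continuous. Qed.

Lemma total_base_continuous : continuous total_base.
Proof.
by move=> x; exact: (cvg_comp _ _ (@total_val_continuous x) cvg_fst).
Qed.

Lemma total_fibre_continuous : continuous total_fibre.
Proof.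
by move=> x; exact: (cvg_comp _ _ (@total_val_continuous x) cvg_snd).
Qed.

Lemma total_space_eq (x y : total_space) :
  total_base x = total_base y -> total_fibre x = total_fibre y -> x = y.
Proof.
move=> e1 e2; apply: val_inj; rewrite /total_base /total_fibre in e1 e2 *.
by rewrite [LHS]surjective_pairing e1 e2 -surjective_pairing.
Qed.

Lemma total_cvg (T : Type) (F : set_system T) {FF : Filter F}
    (g : T -> total_space) x :
  total_base (g t) @[t --> F] --> total_base x ->
  total_fibre (g t) @[t --> F] --> total_fibre x -> g t @[t --> F] --> x.
Proof.
move=> g1 g2 A [_ /= [[W oW <-] Wx WA]].
have gW : (total_base (g t), total_fibre (g t)) @[t --> F] -->
    (total_base x, total_fibre x) by exact: cvg_pair.
have nW : nbhs (total_base x, total_fibre x) W.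
  by apply: open_nbhs_nbhs; split=> //; rewrite -surjective_pairing.
have nT : \forall t \near F, W (total_base (g t), total_fibre (g t)) by exact: gW.
apply: filterS nT => t /= Wt; apply: WA => /=.
by rewrite [set_val _]surjective_pairing.
Qed.

Lemma total_hausdorff : hausdorff_space M -> hausdorff_space E ->
  hausdorff_space total_space.
Proof.
move=> hM hE x y xy; apply: total_space_eq.
  apply: hM => A B nA nB.
  have [z [zA zB]] := xy _ _ (total_base_continuous nA) (total_base_continuous nB).
  by exists (total_base z).
apply: hE => A B nA nB.
have [z [zA zB]] := xy _ _ (total_fibre_continuous nA) (total_fibre_continuous nB).
by exists (total_fibre z).
Qed.

Lemma total_frames : (forall p0 : M, exists (U : set M) (s : 'I_n -> M -> E),
    [/\ open U, U p0, forall k q, U q -> {for q, continuous (s k)},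
        forall q z, U q -> N q z <-> exists k, z = s k q &
        forall q, U q -> injective (s^~ q)]) ->
  frames_of_sections n total_base.
Proof.
move=> fr p0; have [U [s [oU Up cs Ns injs]]] := fr p0.
pose over q k (x : total_space) := total_base x = q /\ total_fibre x = s k q.
have ex k q : U q -> exists x, over q k x.
  move=> Uq; have Nq : N q (s k q) by apply/(Ns q _ Uq); exists k.
  by exists (exist _ (q, s k q) (mem_set Nq)).
have Np0 k : N p0 (s k p0) by apply/(Ns p0 _ Up); exists k.
pose d k : total_space := exist _ (p0, s k p0) (mem_set (Np0 k)).
(* The default [d k], a point over [p0], can be taken only outside [U], where nothing is claimed. *)
pose t k q := xget (d k) (over q k).
have tP k q : U q -> over q k (t k q) by move=> /(ex k)[x]; exact: xgetI.
exists U, t; split; [exact: oU|exact: Up| | |].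
- move=> k q Uq; split; last exact: (tP k q Uq).1.
  have nU : \forall r \near q, U r by exact: open_nbhs_nbhs.
  suff ct : t k r @[r --> q] --> t k q by exact: ct.
  apply: total_cvg; rewrite ?(tP k q Uq).1 ?(tP k q Uq).2.
    have idq : r @[r --> q] --> q by exact: cvg_id.
    by apply: near_cvg idq; apply: filterS nU => r Ur; rewrite (tP k r Ur).1.
  have sq : s k r @[r --> q] --> s k q by exact: cs.
  by apply: near_cvg sq; apply: filterS nU => r Ur; rewrite (tP k r Ur).2.
- move=> x Ux; have [k xk] := (Ns _ _ Ux).1 (total_spaceP x); exists k.
  by apply: total_space_eq; rewrite ?(tP k _ Ux).1 ?(tP k _ Ux).2.
- move=> q Uq k l tkl; apply: (injs q Uq) => /=.
  by rewrite -(tP k q Uq).2 -(tP l q Uq).2 /= tkl.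
Qed.

End TotalSpace.

(** * The complex structure lifted to a covering space *)

Section LiftedSurface.
Variables (R : realType) (M : riemannSurface R) (X : topologicalType).
Variables (n : nat) (h : X -> M).
Local Notation C := (Cplx R).

(** In such a pair of charts [h] reads as the identity, so transition maps upstairs, and coordinate
    expressions of maps composed with [h], agree with those on [M]. *)
Definition chart_over (phi : chart R M) (psi : chart R X) : Prop :=
  forall x, cdom psi x -> cdom phi (h x) /\ cmap psi x = cmap phi (h x).

Definition lifted_atlas : set (chart R X) :=
  [set psi | exists2 phi, atlas M phi & chart_over phi psi].

Lemma chart_over_inv phi psi z : chart_over phi psi -> crange psi z ->
  crange phi z /\ h (cinv psi z) = cinv phi z.
Proof.
move=> ov rz; have [dh e] := ov _ (cinv_dom rz).
have ze : z = cmap phi (h (cinv psi z)) by rewrite -e cinvK.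
split; first by rewrite ze; exact: cmap_range.
by rewrite [in RHS]ze cmapK.
Qed.

Hypothesis X_haus : hausdorff_space X.
Hypothesis X_conn : connected [set: X].
Hypothesis X_nonempty : [set: X] !=set0.
Hypothesis h_cont : continuous h.
Hypothesis h_frames : frames_of_sections n h.

(** The chart is [cmap phi \o h] on the sheet through [x] over [U'], with inverse
    [t k \o cinv phi]. *)
Lemma lifted_atlas_cover x : exists2 psi, lifted_atlas psi & cdom psi x.
Proof.
have [phi aphi xphi] := atlas_cover (h x).
have [U [t [oU Ux ct exht injt]]] := h_frames (h x).
have [k xk] := exht x Ux.
pose U' := U `&` cdom phi.
have oU' : open U' by apply: openI => //; exact: cdom_open.
have oD : open (t k @` U').
  apply: (open_sheet X_haus h_cont k oU').
  - by move=> j q [Uq _]; exact: ct.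
  - by move=> y [Uy _]; exact: exht.
  - by move=> q [Uq _]; exact: injt.
have oR : open (crange phi `&` cinv phi @^-1` U).
  rewrite openE => z [rz Uz]; apply: filterI.
    by apply: open_nbhs_nbhs; split=> //; exact: crange_open.
  exact: (cinv_continuous rz (open_nbhs_nbhs (conj oU Uz))).
have mr y : (t k @` U') y -> (crange phi `&` cinv phi @^-1` U) (cmap phi (h y)).
  move=> [q [Uq dq] <-]; rewrite (ct k q Uq).2; split; first exact: cmap_range.
  by rewrite /preimage /= cmapK.
have rd z : (crange phi `&` cinv phi @^-1` U) z -> (t k @` U') (t k (cinv phi z)).
  by move=> [rz Uz]; exists (cinv phi z) => //; split=> //; exact: cinv_dom.
have mK y : (t k @` U') y -> t k (cinv phi (cmap phi (h y))) = y.
  by move=> [q [Uq dq] <-]; rewrite (ct k q Uq).2 cmapK.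
have iK z : (crange phi `&` cinv phi @^-1` U) z ->
    cmap phi (h (t k (cinv phi z))) = z.
  by move=> [rz Uz]; rewrite (ct k _ Uz).2 cinvK.
have mc y : (t k @` U') y -> {for y, continuous (cmap phi \o h)}.
  move=> [q [Uq dq] <-]; apply: continuous_comp; first exact: h_cont.
  by rewrite (ct k q Uq).2; exact: cmap_continuous.
have ic z : (crange phi `&` cinv phi @^-1` U) z ->
    {for z, continuous (t k \o cinv phi)}.
  move=> [rz Uz]; apply: continuous_comp; first exact: cinv_continuous.
  exact: (ct k _ Uz).1.
exists (Chart oD oR mr rd mK iK mc ic).
  by exists phi => // y /= [q [Uq dq] <-]; rewrite (ct k q Uq).2.
by rewrite /= xk; exists (h x) => //.
Qed.

Lemma near_cinv (T : topologicalType) (psi : chart R T) z (D : set T) :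
  crange psi z -> open D -> D (cinv psi z) ->
  \forall w \near z, crange psi w /\ D (cinv psi w).
Proof.
move=> rz oD Dz.
have n1 : \forall w \near z, crange psi w.
  by apply: open_nbhs_nbhs; split=> //; exact: crange_open.
have n2 : \forall w \near z, D (cinv psi w).
  exact: (cinv_continuous rz (open_nbhs_nbhs (conj oD Dz))).
by apply: filterS2 n1 n2 => w.
Qed.

Lemma lifted_atlas_compatible psi psi' : lifted_atlas psi -> lifted_atlas psi' ->
  holomorphic_in psi psi' id.
Proof.
move=> [phi aphi ov] [phi' aphi' ov'] z rz dz.
have [rz' ez] := chart_over_inv ov rz.
have := near_cinv rz (cdom_open psi') dz => nz.
apply: (near_eq_derivable (f := fun w => cmap phi' (id (cinv phi w)))).
  apply: filterS nz => w [rw dw].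
  by rewrite -(chart_over_inv ov rw).2 (ov' _ dw).2.
apply: (atlas_compatible aphi aphi' rz').
by rewrite /= -ez; exact: (ov' _ dz).1.
Qed.

Definition lifted_surface : riemannSurface R :=
  @RiemannSurface R X lifted_atlas X_nonempty X_haus X_conn lifted_atlas_cover
    lifted_atlas_compatible.

Lemma lifted_holomorphic : @holomorphic_map R lifted_surface M h.
Proof.
split=> // psi phi' [phi aphi ov] aphi' z rz dz.
have [rz' ez] := chart_over_inv ov rz.
have oD : open (h @^-1` cdom phi').
  by apply: open_comp; [move=> x _; exact: h_cont|exact: cdom_open].
have nz := near_cinv rz oD dz.
apply: (near_eq_derivable (f := fun w => cmap phi' (id (cinv phi w)))).
  by apply: filterS nz => w [rw _]; rewrite (chart_over_inv ov rw).2.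
by apply: (atlas_compatible aphi aphi' rz'); rewrite /= -ez.
Qed.

End LiftedSurface.

(** * Immersions and lifts pulled back along a local isomorphism *)

Section Pullback.
Variables (R : realType) (M Y : riemannSurface R) (f : M -> CP2 R) (h : Y -> M).
Local Notation C := (Cplx R).
Local Notation V3 := 'rV[Cplx R]_3.

Hypothesis h_cont : continuous h.
Hypothesis Y_over : forall psi, atlas Y psi ->
  exists2 phi, atlas M phi & chart_over h phi psi.
Hypothesis f_imm : immersion f.

Lemma coord_expr_over phi psi i x : chart_over h phi psi -> coord_range psi x ->
  coord_expr (f \o h) psi i x = coord_expr f phi i x.
Proof.
by move=> ov rx; rewrite /coord_expr /in_coord /= (chart_over_inv ov rx).2.
Qed.

Lemma open_affine_pullback i : open ((f \o h) @^-1` @affine_dom R i).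
Proof.
have hc : {in h @^-1` (f @^-1` @affine_dom R i), continuous h}.
  by move=> y _; exact: h_cont.
exact: (open_comp hc (f_imm.1 i).1).
Qed.

Lemma immersion_over : immersion (f \o h).
Proof.
split=> [i|x psi i [apsi dx xi]].
  split.
    exact: open_affine_pullback.
  move=> psi apsi; have [phi aphi ov] := Y_over apsi.
  set W := coord_range psi `&` _.
  have oW : open W.
    rewrite openE => x [rx xi]; apply: filterI.
      by apply: open_nbhs_nbhs; split=> //; exact: open_coord_range.
    have oi : open ((f \o h) @^-1` @affine_dom R i) by exact: open_affine_pullback.
    have cx : {for x, continuous (in_coord psi id)} by exact: in_coord_continuous.
    exact: (cx _ (open_nbhs_nbhs (conj oi xi))).
  have sub : W `<=` coord_dom f phi i.
    move=> x [rx xi]; have [rx' ex] := chart_over_inv ov rx.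
    by split; [exact: rx'|rewrite /preimage /in_coord /= -ex].
  have sW := @smooth_coord_expr _ _ _ f_imm phi i aphi.
  move=> j; have [sr si] := sW j; split=> k.
    apply: (Ck_eq oW _ (Ck_sub sub (sr k))) => x [rx _].
    by rewrite -(coord_expr_over i ov rx).
  apply: (Ck_eq oW _ (Ck_sub sub (si k))) => x [rx _].
  by rewrite -(coord_expr_over i ov rx).
have [phi aphi ov] := Y_over apsi.
have [dhx ex] := ov x dx.
have inj := f_imm.2 (h x) phi i (And3 aphi dhx xi).
have dE v : differential (f \o h) psi i x v = differential f phi i (h x) v.
  rewrite /differential -ex; apply: near_eq_dvec.
  have nr : \forall y \near of_Cplx (cmap psi x), coord_range psi y.
    apply: open_nbhs_nbhs; split; first exact: open_coord_range.
    by rewrite /coord_range /= to_CplxK; exact: cmap_range.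
  by apply: filterS nr => y ry; exact: coord_expr_over.
by move=> v w; rewrite !dE; exact: inj.
Qed.

Hypothesis f_real : forall p, ~ complex_point f p.

(** It serves twice: with [h] the identity of [M], where [Z] comes from a section of the covering,
    and with [h] the covering map, where [Z] is the tautological projection. *)
Lemma global_lift_of_normalized (Z : Y -> V3) : continuous Z ->
  (forall y, normalized f (h y) (Z y)) -> has_global_lift (f \o h).
Proof.
move=> cZ nZ.
have Z1 y : \sum_j `|Z y 0 j| ^+ 2 == 1.
  by have [phi [i [_ [_ z1 _]]]] := nZ y; apply/eqP.
pose F y : S5 R := exist (fun z : V3 => \sum_j `|z 0 j| ^+ 2 == 1) (Z y) (Z1 y).
exists F; split.
  move=> psi apsi; have [phi aphi ov] := Y_over apsi.
  apply: (normalized_smooth f_imm f_real aphi).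
  - exact: open_coord_range.
  - by move=> x rx; exact: (chart_over_inv ov rx).1.
  - move=> x rx.
    by apply: (in_coord_continuous rx); exact: cZ.
  - move=> x rx; rewrite -(chart_over_inv ov rx).2; exact: nZ.
apply/funext => y; have [phi [i [[_ _ yi] [zE _ _]]]] := nZ y.
by rewrite /= (hopf_affine (z := F y) yi).
Qed.

End Pullback.

Theorem corollaryA7 (R : realType) (M : riemannSurface R) (f : M -> CP2 R)
    (hM : ~ homeomorphic_S2 R M)
    (hf : conformal_immersion f)
    (hc : forall p : M, ~ complex_point f p) :
  has_global_lift f \/
  (~ has_global_lift f /\
   exists (Mhat : riemannSurface R) (tau : Mhat -> M),
     [/\ holomorphic_map tau,
         covering_map 3 tau,
         immersion (f \o tau) &
         has_global_lift (f \o tau)]).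
Proof.
have [lift|nolift] := pselect (has_global_lift f); first by left.
right; split=> //; have [f_imm _] := hf.
pose X := total_space (normalized f); pose tau : X -> M := @total_base _ _ _.
have fr : frames_of_sections 3 tau.
  by apply: total_frames => p; exact: local_frame.
have X_haus : hausdorff_space X.
  by apply: total_hausdorff; [exact: rs_hausdorff|exact: norm_hausdorff].
have tau_cont : continuous tau by exact: total_base_continuous.
have fib_cont : continuous (@total_fibre _ _ (normalized f)).
  exact: total_fibre_continuous.
have X_nonempty : [set: X] !=set0.
  have [p _] := rs_nonempty M; have [U [t [_ Up _ _ _]]] := fr p.
  by exists (t 0 p).
have X_conn : connected [set: X].
  (* A continuous section would select a normalized value over every point of [M], hence give a lift
     of [f] itself. *)
  apply: (three_sheeted_connected (rs_connected (r := M)) fr) => s cs hs.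
  apply: nolift; have -> : f = f \o id by [].
  apply: (@global_lift_of_normalized R M M f id _ f_imm hc
    (fun p => total_fibre (s p))).
  - by move=> psi apsi; exists psi.
  - by move=> p; exact: (cvg_comp _ _ (cs p) (fib_cont (s p))).
  - move=> p; have np : normalized f (tau (s p)) (total_fibre (s p)).
      exact: (total_spaceP (s p)).
    by rewrite hs in np.
pose Y := lifted_surface X_haus X_conn X_nonempty tau_cont fr.
have Yover (psi : chart R Y) : atlas Y psi ->
    exists2 phi, atlas M phi & chart_over tau phi psi by exact.
exists Y, tau; split.
- exact: lifted_holomorphic.
- exact: frames_covering_map.
- exact: (@immersion_over R M Y f tau tau_cont Yover f_imm).
- apply: (@global_lift_of_normalized R M Y f tau Yover f_imm hc
    (@total_fibre _ _ (normalized f))) => //.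
  exact: (@total_spaceP _ _ (normalized f)).
Qed.
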